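(* Let $p\neq 2$ be a prime, $d\ge 3$, and let $H$ be a $d$-generator special $p$-group of rank $\frac12 d(d-1)$. Then $H\wedge H$ is abelian and $|H\wedge H|\le p^{\frac16 d(d-1)(2d+5)}$. Moreover, $\exp(H)=p$ if and only if $H\wedge H\cong\mathbb{Z}_p^{(\frac16 d(d-1)(2d+5))}$.
   Context: A special $p$-group is a finite non-abelian $p$-group $H$ with $H'=Z(H)=\Phi(H)$ elementary abelian; it has rank $k$ if $|H'|=p^k$. ''$d$-generator'' means that the minimal number of generators is $d$. $\exp$ denotes the exponent and $\mathbb{Z}_p^{(r)}$ the direct product of $r$ copies of the cyclic group of order $p$. The non-abelian tensor square $H\otimes H$ is the group generated by symbols $g\otimes h$ ($g,h\in H$) subject to $gg'\otimes h=({}^gg'\otimes{}^gh)(g\otimes h)$ and $g\otimes hh'=(g\otimes h)({}^hg\otimes{}^hh')$, where ${}^gx=gxg^{-1}$. The non-abelian exterior square is $H\wedge H=(H\otimes H)/\nabla(H)$, where $\nabla(H)=\langle g\otimes g\mid g\in H\rangle$. *)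

(* Defs.v *)
From HB Require Import structures.
From mathcomp Require Import all_boot all_fingroup all_algebra all_solvable.
From mathcomp Require Import boolp classical_sets cardinality.

Set Implicit Arguments.
Unset Strict Implicit.
Unset Printing Implicit Defensive.

Local Open Scope group_scope.
Local Open Scope quotient_scope.

(* fingroup shadows the name repr. *)
Local Notation repr := generic_quotient.repr.

(* Groups given by generators and relations: words in the letters x (encoded  *)
(* as (true, x)) and x^-1 (encoded as (false, x)), modulo the congruence      *)
(* generated by free cancellation and by the relations u = v for R u v.       *)

Definition word (X : Type) := seq (bool * X).

Definition letter {X : Type} (x : X) : bool * X := (true, x).

Definition invw (X : Type) (w : word X) : word X :=
  rev [seq (~~ l.1, l.2) | l <- w].

Inductive pres_eq (X : Type) (R : word X -> word X -> Prop) :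
  word X -> word X -> Prop :=
| PresRefl u : pres_eq R u u
| PresSym u v : pres_eq R u v -> pres_eq R v u
| PresTrans u v w : pres_eq R u v -> pres_eq R v w -> pres_eq R u w
| PresCat u u' v v' :
    pres_eq R u u' -> pres_eq R v v' -> pres_eq R (u ++ v) (u' ++ v')
| PresCancel b x : pres_eq R [:: (b, x); (~~ b, x)] [::]
| PresRel u v : R u v -> pres_eq R u v.

Section Presentation.
Variables (X : choiceType) (R : word X -> word X -> Prop).
Implicit Types u v w : word X.

Definition pres_eqb : rel (word X) := fun u v => `[< pres_eq R u v >].

Fact pres_eqb_refl : reflexive pres_eqb.
Proof. by move=> u; apply/asboolP; exact: PresRefl. Qed.

Fact pres_eqb_sym : symmetric pres_eqb.
Proof. by move=> u v; apply/asboolP/asboolP; exact: PresSym. Qed.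

Fact pres_eqb_trans : transitive pres_eqb.
Proof.
move=> v u w /asboolP uv /asboolP vw; apply/asboolP.
exact: PresTrans uv vw.
Qed.

Canonical pres_equiv :=
  EquivRel pres_eqb pres_eqb_refl pres_eqb_sym pres_eqb_trans.

Definition presented : Type := {eq_quot pres_equiv}.
HB.instance Definition _ := Choice.on presented.
HB.instance Definition _ := Quotient.on presented.
HB.instance Definition _ := EqQuotient.on presented.

Definition pres_class (w : word X) : presented := \pi_presented w.

Lemma pres_classP u v : pres_class u = pres_class v <-> pres_eq R u v.
Proof.
split=> [/eqP|uv]; first by rewrite /pres_class eqmodE => /asboolP.
by apply/eqP; rewrite /pres_class eqmodE; apply/asboolP.
Qed.

Lemma pres_class_repr (x : presented) : pres_class (repr x) = x.
Proof. exact: reprK. Qed.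

Lemma pres_repr u : pres_eq R (repr (pres_class u)) u.
Proof. by apply/pres_classP; rewrite pres_class_repr. Qed.

Fact pres_catV w : pres_eq R (w ++ invw w) [::].
Proof.
elim: w => [|[b x] w IH]; first exact: PresRefl.
rewrite /invw /= rev_cons -cats1 catA -/(invw w).
apply: PresTrans (PresCancel R b x).
apply: (@PresCat _ _ [:: (b, x)] [:: (b, x)] _ [:: (~~ b, x)]).
  exact: PresRefl.
exact: (PresCat IH (PresRefl R [:: (~~ b, x)])).
Qed.

Fact pres_Vcat w : pres_eq R (invw w ++ w) [::].
Proof.
have invwK : invw (invw w) = w.
  rewrite /invw map_rev revK -map_comp -[RHS]map_id.
  by apply: eq_map => -[b x] /=; rewrite negbK.
by rewrite -{2}invwK; exact: pres_catV.
Qed.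

Lemma pres_eq_invw u v : pres_eq R u v -> pres_eq R (invw u) (invw v).
Proof.
move=> uv; apply: (@PresTrans _ _ _ (invw u ++ (v ++ invw v))).
  rewrite -[X in pres_eq R X _]cats0.
  by apply: PresCat; [exact: PresRefl | exact/PresSym/pres_catV].
rewrite catA; apply: (@PresCat _ _ _ [::] _ (invw v)); last exact: PresRefl.
apply: PresTrans (pres_Vcat u).
by apply: PresCat; [exact: PresRefl | exact: PresSym].
Qed.

Definition pres_mul (x y : presented) : presented :=
  pres_class (repr x ++ repr y).
Definition pres_one : presented := pres_class [::].
Definition pres_inv (x : presented) : presented := pres_class (invw (repr x)).

Fact pres_class_cat u v :
  pres_class (u ++ v) = pres_mul (pres_class u) (pres_class v).
Proof.
by apply/pres_classP; apply: PresSym; apply: PresCat; exact: pres_repr.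
Qed.

Fact pres_class_inv u : pres_class (invw u) = pres_inv (pres_class u).
Proof.
by apply/pres_classP; apply: PresSym; apply/pres_eq_invw/pres_repr.
Qed.

Fact pres_mulA : associative pres_mul.
Proof.
move=> x y z; rewrite -(pres_class_repr x) -(pres_class_repr y).
by rewrite -(pres_class_repr z) -!pres_class_cat catA.
Qed.

Fact pres_mul1 : left_id pres_one pres_mul.
Proof. by move=> x; rewrite -(pres_class_repr x) -pres_class_cat. Qed.

Fact pres_mulr1 : right_id pres_one pres_mul.
Proof. by move=> x; rewrite -(pres_class_repr x) -pres_class_cat cats0. Qed.

Fact pres_mulV : right_inverse pres_one pres_inv pres_mul.
Proof.
move=> x; rewrite -(pres_class_repr x) -pres_class_inv -pres_class_cat.
exact/pres_classP/pres_catV.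
Qed.

Fact pres_Vmul : left_inverse pres_one pres_inv pres_mul.
Proof.
move=> x; rewrite -[LHS]pres_mulr1 -(pres_mulV (pres_inv x)) pres_mulA.
by rewrite -(pres_mulA _ x) pres_mulV pres_mulr1.
Qed.

HB.instance Definition _ := isGroup.Build presented
  pres_mulA pres_mul1 pres_mulr1 pres_Vmul pres_mulV.

Definition pres_gen (x : X) : presented := pres_class [:: letter x].

Lemma pres_classM u v : pres_class (u ++ v) = pres_class u * pres_class v.
Proof. exact: pres_class_cat. Qed.

Lemma pres_ind (P : presented -> Prop) :
    P 1 -> (forall x t, P t -> P (pres_gen x * t)) ->
    (forall x t, P t -> P ((pres_gen x)^-1 * t)) -> forall t, P t.
Proof.
move=> P1 PM PV t; rewrite -(pres_class_repr t).
elim: (repr t) => [//|[b x] w IH]; rewrite -cat1s pres_classM.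
case: b; first exact: PM.
suff -> : pres_class [:: (false, x)] = (pres_gen x)^-1 by exact: PV.
exact: (pres_class_inv [:: letter x]).
Qed.

End Presentation.

Definition subgroup (G : groupType) (A : set G) : Prop :=
  A 1 /\ forall x y, A x -> A y -> A (x * y^-1).

Definition gen_subgroup (G : groupType) (S : set G) : set G :=
  smallest (@subgroup G) S.

(* Left conjugation; the library's x ^ g is g^-1 * x * g. *)
Definition lconj (G : groupType) (g x : G) : G := g * x * g^-1.

Definition normal_subgroup (G : groupType) (A : set G) : Prop :=
  subgroup A /\ forall g x, A x -> A (lconj g x).

Section Quotient.
Variables (G : groupType) (N : set G) (nN : normal_subgroup N).
Implicit Types x y : G.

(* The unused argument nN lets the canonical equivalence below be inferred. *)
Definition coset_eq (nN : normal_subgroup N) : rel G :=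
  fun x y => `[< N (x * y^-1) >].

Fact coset_eq_refl : reflexive (coset_eq nN).
Proof. by move=> x; apply/asboolP; rewrite mulgV; case: nN => -[]. Qed.

Fact subgroupV x : N x -> N x^-1.
Proof. by case: nN => -[N1 ND] _ Nx; rewrite -[_^-1]mul1g; exact: ND. Qed.

Fact subgroupM x y : N x -> N y -> N (x * y).
Proof.
move=> Nx /subgroupV Ny; rewrite -[y]invgK.
by case: nN => -[_ ND] _; exact: ND.
Qed.

Fact coset_eq_sym : symmetric (coset_eq nN).
Proof.
by move=> x y; apply/asboolP/asboolP => /subgroupV; rewrite invMg invgK.
Qed.

Fact coset_eq_trans : transitive (coset_eq nN).
Proof.
move=> y x z /asboolP Nxy /asboolP Nyz; apply/asboolP.
by have := subgroupM Nxy Nyz; rewrite mulgA mulgKV.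
Qed.

Canonical coset_equiv :=
  EquivRel (coset_eq nN) coset_eq_refl coset_eq_sym coset_eq_trans.

Definition quot_group : Type := {eq_quot coset_equiv}.
HB.instance Definition _ := Choice.on quot_group.
HB.instance Definition _ := Quotient.on quot_group.
HB.instance Definition _ := EqQuotient.on quot_group.

Definition quot_class x : quot_group := \pi_quot_group x.

Lemma quot_classP x y : quot_class x = quot_class y <-> N (x * y^-1).
Proof.
split=> [/eqP|xy]; first by rewrite /quot_class eqmodE => /asboolP.
by apply/eqP; rewrite /quot_class eqmodE; apply/asboolP.
Qed.

Lemma quot_class_repr (a : quot_group) : quot_class (repr a) = a.
Proof. exact: reprK. Qed.

Lemma quot_repr x : N (repr (quot_class x) * x^-1).
Proof. by apply/quot_classP; rewrite quot_class_repr. Qed.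

Definition quot_mul (a b : quot_group) : quot_group :=
  quot_class (repr a * repr b).
Definition quot_one : quot_group := quot_class 1.
Definition quot_inv (a : quot_group) : quot_group := quot_class (repr a)^-1.

Fact quot_class_mul x y :
  quot_class (x * y) = quot_mul (quot_class x) (quot_class y).
Proof.
apply/esym/quot_classP; case: (nN) => _ NJ.
set x' := repr _; set y' := repr _.
have := subgroupM (NJ x' _ (quot_repr y)) (quot_repr x).
by rewrite /lconj invMg !mulgA mulgKV.
Qed.

Fact quot_class_inv x : quot_class x^-1 = quot_inv (quot_class x).
Proof.
apply/quot_classP; case: (nN) => _ NJ; rewrite invgK.
have := NJ x^-1 _ (quot_repr x).
by rewrite /lconj invgK !mulgA mulgKV.
Qed.

Fact quot_mulA : associative quot_mul.
Proof.
move=> a b c; rewrite -(quot_class_repr a) -(quot_class_repr b).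
by rewrite -(quot_class_repr c) -!quot_class_mul mulgA.
Qed.

Fact quot_mul1 : left_id quot_one quot_mul.
Proof. by move=> a; rewrite -(quot_class_repr a) -quot_class_mul mul1g. Qed.

Fact quot_mulr1 : right_id quot_one quot_mul.
Proof. by move=> a; rewrite -(quot_class_repr a) -quot_class_mul mulg1. Qed.

Fact quot_Vmul : left_inverse quot_one quot_inv quot_mul.
Proof.
move=> a; rewrite -(quot_class_repr a) -quot_class_inv -quot_class_mul.
by rewrite mulVg.
Qed.

Fact quot_mulV : right_inverse quot_one quot_inv quot_mul.
Proof.
move=> a; rewrite -(quot_class_repr a) -quot_class_inv -quot_class_mul.
by rewrite mulgV.
Qed.

HB.instance Definition _ := isGroup.Build quot_group
  quot_mulA quot_mul1 quot_mulr1 quot_Vmul quot_mulV.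

End Quotient.

Inductive tensor_rel (G : groupType) : word (G * G) -> word (G * G) -> Prop :=
| TensorMl g g' h :
    tensor_rel [:: letter (g * g', h)]
               [:: letter (lconj g g', lconj g h); letter (g, h)]
| TensorMr g h h' :
    tensor_rel [:: letter (g, h * h')]
               [:: letter (g, h); letter (lconj h g, lconj h h')].

Section ExteriorSquare.
Variable G : groupType.
Implicit Types g h : G.

Definition tensor_square : groupType := presented (@tensor_rel G).

Definition tensor g h : tensor_square := pres_gen (@tensor_rel G) (g, h).

Lemma tensorMl g g' h :
  tensor (g * g') h = tensor (lconj g g') (lconj g h) * tensor g h.
Proof. by rewrite -pres_classM; apply/pres_classP/PresRel/TensorMl. Qed.

Lemma tensorMr g h h' :
  tensor g (h * h') = tensor g h * tensor (lconj h g) (lconj h h').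
Proof. by rewrite -pres_classM; apply/pres_classP/PresRel/TensorMr. Qed.

Definition nabla : set tensor_square :=
  gen_subgroup (range (fun g => tensor g g)).

Fact lconjM g x y : lconj g (x * y) = lconj g x * lconj g y.
Proof. by rewrite /lconj !mulgA mulgKV. Qed.

Fact lconjA g h x : lconj g (lconj h x) = lconj (g * h) x.
Proof. by rewrite /lconj invMg !mulgA. Qed.

Fact tensor_swap g h x y :
  tensor (lconj (g * h) x) (lconj (g * h) y) * tensor g h =
  tensor g h * tensor (lconj (h * g) x) (lconj (h * g) y).
Proof.
have lconjK a b : lconj a b * a = a * b by rewrite /lconj mulgKV.
have E1 : tensor (g * x) (h * y) = tensor (lconj g x) (lconj g h) *
    (tensor (lconj (g * h) x) (lconj (g * h) y) * tensor g h) *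
    tensor (lconj h g) (lconj h y).
  rewrite (tensorMl g x) (lconjM g h) (tensorMr (lconj g x)) (tensorMr g h).
  by rewrite !(lconjA (lconj g h)) lconjK !mulgA.
have E2 : tensor (g * x) (h * y) = tensor (lconj g x) (lconj g h) *
    (tensor g h * tensor (lconj (h * g) x) (lconj (h * g) y)) *
    tensor (lconj h g) (lconj h y).
  rewrite (tensorMr _ h) (lconjM h g) (tensorMl (lconj h g)) (tensorMl g x).
  by rewrite !(lconjA (lconj h g)) lconjK !mulgA.
by move: E1; rewrite E2 => /mulIg/mulgI.
Qed.

Fact nabla_subgroup : subgroup nabla.
Proof.
split=> [A [[A1 _] _] //|x y Nx Ny A [sA SA]].
by case: (sA) => _; apply; [exact: Nx | exact: Ny].
Qed.

Fact nabla_gen g : nabla (tensor g g).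
Proof. by move=> A [_]; apply; exists g. Qed.

Fact nabla_normal : normal_subgroup nabla.
Proof.
split; first exact: nabla_subgroup.
have lconjT (t : tensor_square) :
    (forall g, nabla (lconj t (tensor g g))) ->
    forall x, nabla x -> nabla (lconj t x).
  move=> Ht x Nx; apply: (Nx [set y | nabla (lconj t y)]%classic).
  split; last by move=> _ [g _ <-]; exact: Ht.
  have [N1 ND] := nabla_subgroup.
  split=> [|y z /= Ny Nz]; first by rewrite /= /lconj mulg1 mulgV.
  have := ND _ _ Ny Nz.
  by rewrite /lconj !invMg invgK !mulgA mulgKV.
elim/pres_ind => [x|[g h] t IH x Nx|[g h] t IH x Nx].
- by rewrite /lconj mul1g invg1 mulg1.
- rewrite -[_ * t]/(tensor g h * t).
  have -> : lconj (tensor g h * t) x = lconj (tensor g h) (lconj t x).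
    by rewrite /lconj invMg !mulgA.
  apply: lconjT => [k|]; last exact: IH.
  have := tensor_swap g h (lconj (h * g)^-1 k) (lconj (h * g)^-1 k).
  rewrite !lconjA !mulgV => E.
  have lc1 : lconj 1 k = k by rewrite /lconj mul1g invg1 mulg1.
  rewrite lc1 in E; rewrite /lconj -E mulgK; exact: nabla_gen.
- have -> : lconj ((tensor g h)^-1 * t) x =
      lconj (tensor g h)^-1 (lconj t x) by rewrite /lconj invMg !mulgA.
  apply: lconjT => [k|]; last exact: IH.
  have := tensor_swap g h (lconj (g * h)^-1 k) (lconj (g * h)^-1 k).
  rewrite !lconjA !mulgV => E.
  have lc1 : lconj 1 k = k by rewrite /lconj mul1g invg1 mulg1.
  rewrite lc1 in E; rewrite /lconj invgK -mulgA E mulKg; exact: nabla_gen.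
Qed.

Definition exterior_square : groupType := quot_group nabla_normal.

End ExteriorSquare.

Definition isomorphic (G K : groupType) : Prop :=
  exists f : {multiplicative G -> K}, bijective f.

(* Z_p^(r), with pointwise operations; 'Z_p is the additive group of integers *)
(* mod p for p > 1.                                                           *)
Definition Zp_power (p r : nat) : finGroupType :=
  {dffun forall _ : 'I_r, ('Z_p : finGroupType)}.

Definition special_pgroup (p : nat) (gT : finGroupType) (A : {set gT}) : Prop :=
  [/\ p.-group A, ~~ abelian A, special A & p.-abelem 'Z(A)].

Definition special_rank (p : nat) (gT : finGroupType) (A : {set gT}) (k : nat)
  : Prop := #|A^`(1)| = (p ^ k)%N.

(* Main.v *)
(* Let x_1, ..., x_d generate H. Since H has class two, conjugation by a        *)
(* commutator is trivial, so H /\ H is abelian, and it is generated by the       *)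
(* d(d-1)/2 elements x_i /\ x_j (i < j) together with the elements               *)
(* [x_i, x_j] /\ x_k, of order dividing p and subject to the Jacobi identity,    *)
(* so that the (d^3-d)/3 of them with i < j and k <= j suffice. As p is odd,     *)
(* (x /\ y)^p = x^p /\ y lies in the span of the latter, whence the bound.       *)
(* If exp H = p, the order of H makes it free of class two and exponent p; Fox   *)
(* derivatives then give crossed pairings H x H -> Z/p dual to these generators, *)
(* which are therefore independent. Conversely, if H /\ H is elementary abelian  *)
(* of the maximal order, the generators form a basis, x^p /\ y = 0 for all y,    *)
(* and reading coordinates off x^p /\ x_k for suitable k yields x^p = 1.         *)

From HB Require Import structures.
Require Import Defs.
From mathcomp Require Import all_boot all_fingroup all_algebra all_solvable.
From mathcomp Require Import boolp classical_sets cardinality.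
From mathcomp Require Import ring zify.

Set Implicit Arguments.
Unset Strict Implicit.
Unset Printing Implicit Defensive.

Import GRing.Theory.

Local Open Scope group_scope.

(** * Commutative groups written additively *)

(** For $H$ of class two, $H\wedge H$ is abelian, and its homomorphisms to an abelian group $M$
    correspond to the alternating crossed pairings $w:H\times H\to M$ ([exterior_universal]).
    Generation is therefore proved for an arbitrary $w$, and independence by exhibiting pairings
    into $\mathbb{Z}/p$.

    Such a $w$ is additive up to values $w([g,h],k)$, which are additive in $g,h,k$ and satisfy the
    Jacobi identity ([pairing_jacobi]). Hence the $w(x_i,x_j)$ with $i<j$ and the $w([x_i,x_j],x_k)$
    with $i<j$, $k\le j$ generate. The latter are killed by $p$; for odd $p$ one has
    $p\,w(g,h)=w(g^p,h)$ with $g^p\in H'$, so $p\,w(x_i,x_j)$ lies in their span. Coefficients below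
    $p$ then suffice ([span_wedge]), which gives the bound.

    If $\exp(H)=p$, then $|H|\ge p^{d+d(d-1)/2}$ makes normal forms unique. Their exponents give
    first and second order coordinates ([second_order_coordinates]), and the pairings built from
    these form a triangular system on the generators with diagonal entries 1 or 2 ([wedge_free]).
    Conversely, if $H\wedge H$ is elementary abelian of maximal order, the generators form a basis
    and $w(g^p,\cdot)=0$. As $d\ge3$, some $k$ differs from $a$ and $b$, and the coefficient of
    $[x_a,x_b]$ in $g^p$ is up to sign a coordinate of $w(g^p,x_k)$ ([coefficient_dual]); so it
    vanishes mod $p$, and $g^p=1$. *)

Definition commz (G : groupType) (cG : forall x y : G, x * y = y * x) : Type :=
  G.

Section CommutativeGroup.
Variables (G : groupType) (cG : forall x y : G, x * y = y * x).

HB.instance Definition _ := Choice.on (commz cG).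
HB.instance Definition _ := GRing.isZmodule.Build (commz cG)
  (@mulgA G) cG (@mul1g G) (@mulVg G).

Definition toz (x : G) : commz cG := x.

Lemma tozM x y : toz (x * y) = (toz x + toz y)%R. Proof. by []. Qed.

End CommutativeGroup.

(** * Spanning families of exponent [p] *)

Section Span.
Variables (p : nat) (p_gt1 : (1 < p)%N) (M : zmodType).
Local Open Scope ring_scope.

(** Coefficients act through their representatives $0,\dots,p-1$, since [M] need not be a
    $\mathbb{Z}/p$-module: some [e t] may have order $p^2$, and then [comb] is not additive. It
    still takes at most $p^{|T|}$ values. *)
Definition comb (T : finType) (e : T -> M) (n : {ffun T -> 'Z_p}) : M :=
  \sum_t e t *+ (n t : nat).

Definition pspan (T : finType) (e : T -> M) (m : M) : Prop :=
  exists n, m = comb e n.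

Lemma mulr_modn (x : M) n : x *+ p = 0 -> x *+ (n %% p)%N = x *+ n.
Proof.
by move=> xp0; rewrite [in RHS](divn_eq n p) mulrnDr mulnC mulrnA xp0 mul0rn add0r.
Qed.

Lemma mulr_Zp_nat (x : M) n : x *+ p = 0 -> x *+ ((n%:R : 'Z_p) : nat) = x *+ n.
Proof. by move=> xp0; rewrite val_Zp_nat // mulr_modn. Qed.

Lemma mulr_ZpD (x : M) (a b : 'Z_p) :
  x *+ p = 0 -> x *+ ((a + b)%R : nat) = x *+ a + x *+ b.
Proof.
move=> xp0; rewrite -{1}(natr_Zp a) -{1}(natr_Zp b) -natrD.
by rewrite mulr_Zp_nat // mulrnDr.
Qed.

Section Torsion.
Variables (T : finType) (e : T -> M).
Hypothesis ep0 : forall t, e t *+ p = 0.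

Lemma combD n m : comb e (n + m) = comb e n + comb e m.
Proof. by rewrite -big_split; apply: eq_bigr => t _; rewrite ffunE mulr_ZpD. Qed.

Lemma comb_torsion n : comb e n *+ p = 0.
Proof.
by rewrite /comb -sumrMnl big1 // => t _; rewrite mulrnAC ep0 mul0rn.
Qed.

Lemma span_torsion x : pspan e x -> x *+ p = 0.
Proof. by case=> n ->; exact: comb_torsion. Qed.

Lemma span_nat (n : T -> nat) : pspan e (\sum_t e t *+ n t).
Proof.
exists [ffun t => (n t)%:R]; apply: eq_bigr => t _.
by rewrite ffunE mulr_Zp_nat.
Qed.

End Torsion.

Lemma sum_delta (T : finType) (e : T -> M) t0 :
  \sum_t e t *+ (t == t0) = e t0.
Proof.
by rewrite (bigD1 t0) //= eqxx big1 ?addr0 // => t /negPf ->.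
Qed.

(* Closure of the span under addition only needs that the coefficients can be *)
(* reduced modulo p, possibly at the cost of a carry to other generators.     *)
Section Closed.
Variables (T : finType) (e : T -> M) (q : nat).
Hypothesis q_gt0 : (0 < q)%N.
Hypothesis eq0 : forall t, e t *+ q = 0.
Hypothesis span_natP : forall n : T -> nat, pspan e (\sum_t e t *+ n t).

Lemma span0 : pspan e 0.
Proof. by have := span_natP (fun=> 0%N); rewrite big1. Qed.

Lemma spanD x y : pspan e x -> pspan e y -> pspan e (x + y).
Proof.
move=> [n ->] [m ->]; have := span_natP (fun t => (n t + m t)%N).
by under eq_bigr do rewrite mulrnDr; rewrite big_split.
Qed.

Lemma span_gen t : pspan e (e t).
Proof. by rewrite -sum_delta; exact: span_natP. Qed.

Lemma spanMn x n : pspan e x -> pspan e (x *+ n).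
Proof.
move=> sx; elim: n => [|n IH]; first exact: span0.
by rewrite mulrS; exact: spanD.
Qed.

Lemma spanN x : pspan e x -> pspan e (- x).
Proof.
move=> sx; have xq0 : x *+ q = 0.
  have [n ->] := sx.
  by rewrite /comb -sumrMnl big1 // => t _; rewrite mulrnAC eq0 mul0rn.
suff -> : - x = x *+ q.-1 by exact: spanMn.
by apply/eqP; rewrite eq_sym -addr_eq0 -mulrSr prednK // xq0.
Qed.

Lemma span_sum (I : Type) (r : seq I) (P : pred I) (F : I -> M) :
  (forall i, P i -> pspan e (F i)) -> pspan e (\sum_(i <- r | P i) F i).
Proof. by move=> sF; apply: big_ind => //; [exact: span0 | exact: spanD]. Qed.

End Closed.

Section TwoLevel.
Variables (I J : finType) (e : I -> M) (f : J -> M).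
Hypothesis fp0 : forall j, f j *+ p = 0.
Hypothesis ep_span : forall i, pspan f (e i *+ p).

Definition joint (t : I + J) : M :=
  match t with inl i => e i | inr j => f j end.

Lemma joint_torsion t : joint t *+ (p * p) = 0.
Proof.
case: t => [i|j] /=; rewrite mulrnA ?fp0 ?mul0rn //.
exact: span_torsion (ep_span i).
Qed.

(** Carrying: a coefficient $qp+r$ of [e i] leaves $r$ there, while $q$ times [e i *+ p] moves into
    the span of [f], where coefficients reduce mod $p$. *)
Lemma span_joint_nat (n : I + J -> nat) : pspan joint (\sum_t joint t *+ n t).
Proof.
have spanf_nat := span_nat fp0.
pose y := \sum_i (e i *+ p) *+ (n (inl i) %/ p) + \sum_j f j *+ n (inr j).
have [m ym] : pspan f y.
  apply: (spanD spanf_nat) => //.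
  by apply: (span_sum spanf_nat) => i _; exact: (spanMn spanf_nat).
exists [ffun t => match t with inl i => (n (inl i))%:R | inr j => m j end].
rewrite /comb !big_sumType /=.
under [in RHS]eq_bigr do rewrite ffunE val_Zp_nat //.
under [X in _ = _ + X]eq_bigr do rewrite ffunE.
rewrite -/(comb f m) -ym /y addrA -big_split; congr (_ + _).
apply: eq_bigr => i _; rewrite /= -mulrnA -mulrnDr.
by rewrite addnC mulnC -divn_eq.
Qed.

End TwoLevel.

Lemma comb_surjective (T : finType) (e : T -> M) :
  (forall x, pspan e x) -> exists g : M -> {ffun T -> 'Z_p}, cancel g (comb e).
Proof.
move=> se; have [g gE] := choice se.
by exists g => x; rewrite -gE.
Qed.

End Span.

(** * Alternating crossed pairings on groups of class two *)

(** These are the defining relations of the tensor square, read in [M], and the vanishing of the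
    generators of [nabla]. *)
Definition crossed_pairing (G : groupType) (M : zmodType) (w : G -> G -> M) :=
  [/\ forall g g' h, w (g * g') h = (w (lconj g g') (lconj g h) + w g h)%R,
      forall g h h', w g (h * h') = (w g h + w (lconj h g) (lconj h h'))%R
    & forall g, w g g = 0%R].

Definition central (G : groupType) (z : G) := forall x, z * x = x * z.

(** Locked so that unification does not unfold a commutator into a product. *)
HB.lock Definition lcomm (G : groupType) (g h : G) : G := lconj g h * h^-1.

Section ClassTwo.
Variable G : groupType.
Hypothesis class2 : forall g h : G, central (lcomm g h).

Lemma lcommE (g h : G) : lcomm g h = lconj g h * h^-1.
Proof. by rewrite lcomm.unlock. Qed.

Lemma lconjE (g h : G) : lconj g h = lcomm g h * h.
Proof. by rewrite lcommE mulgVK. Qed.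

Lemma lconj_central (z x : G) : central z -> lconj z x = x.
Proof. by move=> cz; rewrite /lconj cz mulgK. Qed.

Lemma lconj_fix (z x : G) : central z -> lconj x z = z.
Proof. by move=> cz; rewrite /lconj -cz mulgK. Qed.

Lemma lconjgg (g : G) : lconj g g = g.
Proof. by rewrite /lconj mulgK. Qed.

Lemma lcommgg (g : G) : lcomm g g = 1.
Proof. by rewrite lcommE lconjgg mulgV. Qed.

Lemma mulg_lcomm (g h : G) : g * h = lcomm g h * (h * g).
Proof. by rewrite mulgA -lconjE /lconj mulgVK. Qed.

Lemma lcommV (g h : G) : lcomm h g = (lcomm g h)^-1.
Proof. by rewrite !lcommE /lconj !invMg !invgK !mulgA. Qed.

Lemma lcommMl (g g' h : G) : lcomm (g * g') h = lcomm g h * lcomm g' h.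
Proof.
have E : lconj (g * g') h = lcomm g h * lcomm g' h * h.
  rewrite -lconjA (lconjE g' h) lconjM (lconj_fix g (@class2 g' h)).
  by rewrite (lconjE g h) mulgA (@class2 g' h).
by rewrite lcommE E mulgK.
Qed.

Lemma lcommMr (g h h' : G) : lcomm g (h * h') = lcomm g h * lcomm g h'.
Proof.
by rewrite lcommV lcommMl invMg -!(lcommV _ g) class2.
Qed.

Lemma lcomm1r (g : G) : lcomm g 1 = 1.
Proof. by apply: (mulgI (lcomm g 1)); rewrite -lcommMr !mulg1. Qed.

Lemma centralM (x y : G) : central x -> central y -> central (x * y).
Proof. by move=> cx cy t; rewrite -mulgA cy !mulgA cx. Qed.

Section Pairing.
Variables (M : zmodType) (w : G -> G -> M).
Hypothesis cw : crossed_pairing w.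
Local Open Scope ring_scope.
Let wMl := let: And3 a _ _ := cw in a.
Let wMr := let: And3 _ a _ := cw in a.
Let wgg := let: And3 _ _ a := cw in a.

Lemma pairing_anti g h : w h g = - w g h.
Proof.
have conjVK (a b : G) : lconj a (lconj a^-1 b) = b.
  by rewrite lconjA mulgV /lconj mul1g invg1 mulg1.
(* With this [k], expanding [w (g * k) (g * k)] leaves exactly [w h g + w g h], without
   conjugates. *)
pose k := lconj g^-1 h; have <- : lconj g k = h by exact: conjVK.
have := wgg (g * k); rewrite wMl lconjM lconjgg 2!wMr wgg !lconjgg wgg.
by move=> /eqP; rewrite add0r addr0 addr_eq0 => /eqP.
Qed.

Lemma pairing_centralMl z g h : central z -> w (z * g) h = w g h + w z h.
Proof. by move=> cz; rewrite wMl !lconj_central. Qed.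

Lemma pairing_centralMr g z h : central z -> w g (z * h) = w g z + w g h.
Proof. by move=> cz; rewrite wMr !lconj_central. Qed.

Lemma pairing1r g : w g 1 = 0.
Proof.
have c1 : central (1 : G) by move=> x; rewrite mul1g mulg1.
have /eqP := @pairing_centralMr g 1 1 c1.
by rewrite mulg1 -subr_eq subrr => /eqP.
Qed.

Lemma pairing1l h : w 1 h = 0.
Proof. by rewrite pairing_anti pairing1r oppr0. Qed.

Lemma pairing_lcomm g h k :
  w (lcomm g h) k = w (lconj g h) (lconj g k) + w g k
                    - (w (lconj h g) (lconj h k) + w h k).
Proof.
by apply/eqP; rewrite eq_sym subr_eq -!wMl mulg_lcomm pairing_centralMl // addrC.
Qed.

(** For central [z], the expansion of $X=w([g,h],z)$ by [pairing_lcomm] collapses to $X=2X$, so no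
    torsion assumption on [M] is needed. *)
Lemma pairing_lcomm_central g h z : central z -> w (lcomm g h) z = 0.
Proof.
move=> cz; have := pairing_lcomm g h z.
rewrite !(lconj_fix _ cz) (lconjE g) (lconjE h) !pairing_centralMl //.
rewrite (lcommV g h); set X := w (lcomm g h) z.
have -> : w (lcomm g h)^-1 z = - X.
  apply/eqP; rewrite -addr_eq0 -pairing_centralMl; last exact: class2.
  by rewrite mulgV pairing1l.
move=> E; apply: (addrI X); rewrite addr0 [RHS]E opprD opprB !addrA.
by rewrite [RHS](ACl ((1*6)*(3*5)*(2*4))) /= !subrr !add0r.
Qed.

Lemma pairing_central_lcomm g h z : central z -> w z (lcomm g h) = 0.
Proof. by move=> cz; rewrite pairing_anti pairing_lcomm_central ?oppr0. Qed.

(* [w z] kills commutators, so conjugating the second argument has no effect. *)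
Lemma pairing_centralDr z g h : central z -> w z (g * h) = w z g + w z h.
Proof.
move=> cz; rewrite wMr (lconj_fix _ cz) (lconjE g h).
by rewrite (@pairing_centralMr z (lcomm g h)) // pairing_central_lcomm ?add0r.
Qed.

Lemma pairing_centralXr z h n : central z -> w z (h ^+ n) = w z h *+ n.
Proof.
move=> cz; elim: n => [|n IH]; first exact: pairing1r.
by rewrite expgS pairing_centralDr // IH mulrS.
Qed.

Lemma pairing_centralXl z h n : central z -> w (z ^+ n) h = w z h *+ n.
Proof.
move=> cz; elim: n => [|n IH]; first by rewrite pairing1l.
by rewrite expgS pairing_centralMl // IH -mulrSr.
Qed.

Lemma pairing_lconj g h k :
  w (lconj g h) (lconj g k) = w h k + w (lcomm g h) k - w (lcomm g k) h.
Proof.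
rewrite (lconjE g h) pairing_centralMl // (lconjE g k) !pairing_centralMr //.
rewrite pairing_lcomm_central // add0r (pairing_anti (lcomm g k)).
by rewrite (ACl (2*3*1)).
Qed.

Lemma pairing_Mr g h k :
  w g (h * k) = w g h + w g k + w (lcomm h g) k - w (lcomm h k) g.
Proof. by rewrite wMr pairing_lconj !addrA. Qed.

(** Expanding [pairing_lcomm] by [pairing_lconj] reproduces the left-hand side on the right; what
    remains is the cyclic sum. *)
Lemma pairing_jacobi g h k :
  w (lcomm g h) k + w (lcomm h k) g + w (lcomm k g) h = 0.
Proof.
have := pairing_lcomm g h k; rewrite !pairing_lconj.
have neg a b c : w (lcomm a b) c = - w (lcomm b a) c.
  apply/eqP; rewrite -addr_eq0 (lcommV b a) -pairing_centralMl.
    by rewrite mulgV pairing1l.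
  exact: class2.
rewrite (neg h g k) (neg g k h).
set a := w (lcomm g h) k; set b := w (lcomm h k) g; set c := w (lcomm k g) h.
set s := w h k; set t := w g k.
rewrite !opprD !opprK !addrA => /eqP; rewrite -subr_eq0 => /eqP E.
rewrite -[RHS]oppr0 -E !opprD !opprK !addrA.
by rewrite [RHS](ACl ((2*9)*(5*6)*(3*1)*7*8*4)) /= !subrr !add0r.
Qed.

(** Each further factor [x] replaces [h] by $[x,h]h$ in the old value, which adds $n\,w(x,[x,h])$;
    these corrections sum to the binomial coefficient. *)
Lemma pairing_X x h n :
  w (x ^+ n) h = w x h *+ n + w x (lcomm x h) *+ 'C(n, 2).
Proof.
elim: n => [|n IH].
  by rewrite pairing1l !mulr0n addr0.
have fix_x : lconj x (x ^+ n)%g = (x ^+ n)%g.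
  by rewrite /lconj (commuteX n (commute_refl x)) mulgK.
rewrite expgS wMl fix_x (lconjE x h) pairing_centralMr // IH.
rewrite (pairing_anti (lcomm x h)) pairing_centralXr // (pairing_anti x) mulNrn.
rewrite opprK binS bin1 mulrnDr mulrSr.
by rewrite [LHS](AC (1*2*1) (2*4*(3*1))).
Qed.

End Pairing.
End ClassTwo.

(** * The exterior square of a group of class two *)

Definition wedge (G : groupType) (g h : G) : exterior_square G :=
  quot_class (nabla_normal G) (tensor g h).

Lemma quot_classM (G : groupType) (A : set G) (nA : normal_subgroup A) x y :
  quot_class nA (x * y) = quot_class nA x * quot_class nA y.
Proof. exact: quot_class_mul. Qed.

Lemma quot_classV (G : groupType) (A : set G) (nA : normal_subgroup A) x :
  quot_class nA x^-1 = (quot_class nA x)^-1.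
Proof. exact: quot_class_inv. Qed.

Lemma exterior_ind (G : groupType) (P : exterior_square G -> Prop) :
    P 1 -> (forall g h t, P t -> P (wedge g h * t)) ->
    (forall g h t, P t -> P ((wedge g h)^-1 * t)) -> forall t, P t.
Proof.
move=> P1 PM PV t; rewrite -(quot_class_repr t).
elim/pres_ind: (generic_quotient.repr t) => {t} [//|[g h] t|[g h] t] IH.
- by rewrite quot_classM; exact: PM.
- by rewrite quot_classM quot_classV; exact: PV.
Qed.

(** * Universal property: crossed pairings as homomorphisms on the exterior square *)

Section Universal.
Variables (G : groupType) (M : zmodType) (w : G -> G -> M).
Hypothesis cw : crossed_pairing w.
Local Open Scope ring_scope.

Definition eval_word (u : word (G * G)) : M :=
  \sum_(l <- u) (if l.1 then w l.2.1 l.2.2 else - w l.2.1 l.2.2).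

Lemma eval_word_eq u v : pres_eq (@tensor_rel G) u v -> eval_word u = eval_word v.
Proof.
rewrite /eval_word; elim=> {u v} //.
- by move=> u v x _ -> _ ->.
- by move=> u u' v v' _ E1 _ E2; rewrite !big_cat /= E1 E2.
- by case=> -[g h]; rewrite !big_cons !big_nil /= addr0 ?subrr // addNr.
- have [wMl wMr _] := cw.
  move=> u v [g g' h|g h h']; rewrite !big_cons !big_nil /= !addr0.
    exact: wMl.
  exact: wMr.
Qed.

Definition eval_tensor (t : tensor_square G) : M :=
  eval_word (generic_quotient.repr t).

Lemma eval_tensorM s t : eval_tensor (s * t)%g = eval_tensor s + eval_tensor t.
Proof.
rewrite -[RHS](big_cat _ _ _ _ _).
exact/eval_word_eq/pres_repr.
Qed.

Lemma eval_tensorV t : eval_tensor (t^-1)%g = - eval_tensor t.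
Proof.
apply/eqP; rewrite -addr_eq0 -eval_tensorM mulVg; apply/eqP.
have <- : eval_word [::] = 0 by rewrite /eval_word big_nil.
exact/eval_word_eq/pres_repr.
Qed.

Lemma eval_tensorE g h : eval_tensor (tensor g h) = w g h.
Proof.
rewrite /eval_tensor (eval_word_eq (pres_repr _ _)) /eval_word.
by rewrite big_seq1.
Qed.

Lemma eval_nabla t : @nabla G t -> eval_tensor t = 0.
Proof.
have [_ _ wgg] := cw.
(* [nabla] is the intersection of the subgroups containing all [tensor g g]; here it is instantiated
   at the kernel of [eval_tensor]. *)
move=> Nt; apply: (Nt [set t | eval_tensor t = 0]%classic).
split; last by move=> _ [g _ <-] /=; rewrite eval_tensorE.
split=> [|x y /= x0 y0].
  by have := eval_tensorM 1%g 1%g; rewrite mulg1 => /eqP; rewrite -subr_eq subrr => /eqP.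
by rewrite eval_tensorM eval_tensorV x0 y0 subrr.
Qed.

Theorem exterior_universal : exists phi : exterior_square G -> M,
  (forall x y, phi (x * y)%g = phi x + phi y) /\
  (forall g h, phi (wedge g h) = w g h).
Proof.
pose phi (x : exterior_square G) := eval_tensor (generic_quotient.repr x).
have phi_class t : phi (quot_class (nabla_normal G) t) = eval_tensor t.
  have /eval_nabla := quot_repr (nabla_normal G) t.
  by rewrite eval_tensorM eval_tensorV => /eqP; rewrite subr_eq0 => /eqP.
exists phi; split=> [x y|g h]; last by rewrite phi_class eval_tensorE.
rewrite -(quot_class_repr x) -(quot_class_repr y) -quot_classM !phi_class.
exact: eval_tensorM.
Qed.

End Universal.

(** * The exterior square in class two as an additive group *)

Section ExteriorClassTwo.
Variable G : groupType.
Hypothesis class2 : forall g h : G, central (lcomm g h).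

(** By [tensor_swap], conjugation by $g\otimes h$ acts on symbols as conjugation of both entries by
    $[g,h]$, which is trivial because $[g,h]$ is central. *)
Lemma exterior_mulgC (x y : exterior_square G) : x * y = y * x.
Proof.
have conjVK (a b : G) : lconj a (lconj a^-1 b) = b.
  by rewrite lconjA mulgV /lconj mul1g invg1 mulg1.
have swap (g h k l : G) : wedge k l * wedge g h = wedge g h * wedge k l.
  have := tensor_swap g h (lconj (h * g)^-1 k) (lconj (h * g)^-1 l).
  rewrite !conjVK {1 2}(mulg_lcomm g h) -!(lconjA (lcomm g h)) !conjVK.
  by rewrite !lconj_central // /wedge -!quot_classM => ->.
have cw (g h : G) z : commute (wedge g h) z.
  move: z; apply: exterior_ind => [|k l z IH|k l z IH]; first exact: commute1.
    exact: (commuteM (swap k l g h) IH).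
  exact: (commuteM (commuteV (swap k l g h)) IH).
apply: commute_sym; move: x; apply: exterior_ind => [|g h x IH|g h x IH].
- exact: commute1.
- exact: (commuteM (commute_sym (cw g h y)) IH).
- exact: (commuteM (commuteV (commute_sym (cw g h y))) IH).
Qed.

Definition exteriorz : zmodType := commz exterior_mulgC.

Definition wedgez (g h : G) : exteriorz := toz exterior_mulgC (wedge g h).

Lemma wedgez_crossed : crossed_pairing wedgez.
Proof.
split=> [g g' h|g h h'|g].
- by rewrite -tozM /wedgez /wedge -quot_classM -tensorMl.
- by rewrite -tozM /wedgez /wedge -quot_classM -tensorMr.
- by apply/quot_classP; rewrite invg1 mulg1; exact: nabla_gen.
Qed.

Lemma exteriorz_ind (P : exteriorz -> Prop) :
    P 0%R -> (forall x y, P x -> P y -> P (x + y)%R) -> (forall x, P x -> P (- x)%R) ->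
    (forall g h, P (wedgez g h)) -> forall x, P x.
Proof.
move=> P0 PD PN Pw x; move: x; apply: exterior_ind => [//|g h t Pt|g h t Pt].
  by apply: (PD (wedgez g h)).
by apply: (PD (- wedgez g h)%R) => //; exact: PN.
Qed.

End ExteriorClassTwo.

(** * Generators of the exterior square of a special p-group *)

(** There is no case for inverses: in a finite group, a subset containing 1 and closed under
    products is a subgroup. *)
Lemma gen_ind (gT : finGroupType) (A : {set gT}) (P : gT -> Prop) :
    P 1 -> (forall x y, P x -> P y -> P (x * y)) ->
    (forall x, x \in A -> P x) -> forall x, x \in <<A>> -> P x.
Proof.
move=> P1 PM PA x Ax; pose S := [set x | `[< P x >]]%SET.
have gS : group_set S.
  apply/group_setP; split=> [|y z]; rewrite !finset.inE; first by apply/asboolP.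
  by move=> /asboolP Py /asboolP Pz; apply/asboolP/PM.
suff : x \in Group gS by rewrite finset.inE => /asboolP.
apply: fintype.subsetP Ax; rewrite gen_subG; apply/fintype.subsetP => y Ay.
by rewrite finset.inE; apply/asboolP/PA.
Qed.

Definition pair_index (d : nat) : finType := {t : 'I_d * 'I_d | (t.1 < t.2)%N}.

(* Modulo the Jacobi identity, the elements [x_i, x_j] /\ x_k with i < j and   *)
(* k <= j generate all of them: for k > j, rewrite in terms of the two others. *)
Definition triple_index (d : nat) : finType :=
  {t : 'I_d * 'I_d * 'I_d | (t.1.1 < t.1.2)%N && (t.2 <= t.1.2)%N}.

Section Special.
Variables (p d : nat) (G : finGroupType).
Hypotheses (p_pr : prime p) (p_odd : odd p).
Hypothesis class2 : forall g h : G, central (lcomm g h).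
Hypothesis derX : forall z : G, z \in [set: G]^`(1) -> z ^+ p = 1.
Hypothesis power_der : forall x : G, x ^+ p \in [set: G]^`(1).
Variable x : 'I_d -> G.
Hypothesis genx : <<[set x i | i : 'I_d]%SET>> = [set: G]%SET.

Lemma generators_ind (P : G -> Prop) :
    P 1 -> (forall g h, P g -> P h -> P (g * h)) -> (forall i, P (x i)) ->
  forall g, P g.
Proof.
move=> P1 PM Px g; apply: (gen_ind P1 PM) (_ : g \in <<[set x i | i : 'I_d]%SET>>).
  by move=> _ /imsetP[i _ ->].
by rewrite genx finset.inE.
Qed.

Lemma lcomm_der (g h : G) : lcomm g h \in [set: G]^`(1).
Proof.
have -> : lcomm g h = [~ g^-1, h^-1].
  by rewrite lcommE /commg /conjg /lconj !invgK !mulgA.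
by rewrite mem_commg ?finset.inE.
Qed.

Lemma lcommX (g h : G) : lcomm g h ^+ p = 1.
Proof. exact/derX/lcomm_der. Qed.

(** As [lcomm] is bilinear, every commutator is a product of the [lcomm (x i) (x j)]. The product
    case supplies centrality, which lets a pairing split over the product. *)
Lemma derived_ind (P : G -> Prop) :
    P 1 -> (forall y z, central y -> P y -> central z -> P z -> P (y * z)) ->
    (forall i j, P (lcomm (x i) (x j))) ->
  forall z, z \in [set: G]^`(1) -> P z.
Proof.
move=> P1 PM Pc z Gz.
have c1 : central (1 : G) by move=> y; rewrite mul1g mulg1.
have Pxh i h : P (lcomm (x i) h).
  move: h; apply: generators_ind => [|g h Pg Ph|j]; rewrite ?lcomm1r //.
  by rewrite lcommMr //; apply: PM.
have Pgh g h : P (lcomm g h).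
  move: g; apply: generators_ind => [|g g' Pg Pg'|j] //.
    by rewrite lcommV lcomm1r // invg1.
  by rewrite lcommMl //; apply: PM.
pose Q y := central y /\ P y.
suff [] : Q z by [].
move: z Gz; apply: gen_ind => [//|y z [cy Py] [cz Pz]|y].
  by split; [exact: centralM | exact: PM].
case/imset2P=> g h _ _ ->.
have -> : [~ g, h] = lcomm g^-1 h^-1.
  by rewrite lcommE /commg /conjg /lconj !invgK !mulgA.
by split.
Qed.

Lemma derived_central z : z \in [set: G]^`(1) -> central z.
Proof.
move: z; apply: derived_ind => [y|y z cy _ cz _|i j] //.
  by rewrite mul1g mulg1.
exact: centralM.
Qed.

(** * Generators for the values of a crossed pairing *)

Section SpanWedge.
Variables (M : zmodType) (w : G -> G -> M).
Hypothesis cw : crossed_pairing w.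
Local Open Scope ring_scope.

Definition wpair (t : pair_index d) : M := w (x (val t).1) (x (val t).2).

Definition wtriple (t : triple_index d) : M :=
  w (lcomm (x (val t).1.1) (x (val t).1.2)) (x (val t).2).

Let p_gt1 : (1 < p)%N := prime_gt1 p_pr.
Let p_gt0 : (0 < p)%N := prime_gt0 p_pr.

Lemma wtriple_torsion t : wtriple t *+ p = 0.
Proof. by rewrite -(pairing_centralXl cw) // lcommX (pairing1l cw). Qed.

Let sp_nat := span_nat p_gt1 wtriple_torsion.
Let spD := spanD sp_nat.
Let spN := spanN p_gt0 wtriple_torsion sp_nat.

Lemma pairing_lcommN i j h : w (lcomm j i) h = - w (lcomm i j) h.
Proof.
apply/eqP; rewrite -addr_eq0 lcommV -(pairing_centralMl cw); last exact: class2.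
by rewrite mulgV (pairing1l cw).
Qed.

Lemma span_lcomm i j k : pspan p wtriple (w (lcomm (x i) (x j)) (x k)).
Proof.
have main (a b c : 'I_d) : (a < b)%N -> (c <= b)%N ->
    pspan p wtriple (w (lcomm (x a) (x b)) (x c)).
  move=> ab cb; have Ht : (a < b)%N && (c <= b)%N by rewrite ab.
  exact: (span_gen sp_nat (exist _ (a, b, c) Ht : triple_index d)).
wlog ij : i j / (i < j)%N.
  move=> W; have [ij|ji|/ord_inj->] := ltngtP i j; first exact: W.
    by rewrite pairing_lcommN; apply/spN/W.
  by rewrite lcommgg (pairing1l cw); exact: span0 sp_nat.
have [kj|jk] := leqP k j; first exact: main.
have := pairing_jacobi class2 cw (x i) (x j) (x k).
rewrite -addrA => /eqP; rewrite addr_eq0 => /eqP ->; apply/spN/spD.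
  by apply: main => //; exact: ltnW (ltn_trans ij jk).
rewrite pairing_lcommN; apply/spN/main; last exact: ltnW.
exact: ltn_trans jk.
Qed.

Lemma span_derived z h : z \in [set: G]^`(1)%g -> pspan p wtriple (w z h).
Proof.
move=> Gz; have cz := derived_central Gz.
move: h; apply: generators_ind => [|g h|k].
- by rewrite (pairing1r cw); exact: span0 sp_nat.
- by rewrite (pairing_centralDr class2 cw) //; exact: spD.
move: z {cz} Gz; apply: derived_ind => [|y z cy Py cz Pz|i j].
- by rewrite (pairing1l cw); exact: span0 sp_nat.
- by rewrite (pairing_centralMl cw) //; exact: spD.
- exact: span_lcomm.
Qed.

(* The defect [w g (lcomm g h) *+ 'C(p, 2)] vanishes because [p] is odd. *)
Lemma pairing_Xp g h : w (g ^+ p)%g h = w g h *+ p.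
Proof.
rewrite (pairing_X class2) //; set y := w g (lcomm g h).
have yp : y *+ p = 0.
  by rewrite /y (pairing_anti cw) mulNrn -(pairing_centralXl cw) // lcommX
     (pairing1l cw) oppr0.
have [q ->] : exists q, 'C(p, 2) = (p * q)%N.
  have /dvdnP[q ->] : (p %| 'C(p, 2))%N.
    by apply: prime_dvd_bin => //; rewrite odd_prime_gt2.
  by exists q; rewrite mulnC.
by rewrite mulrnA yp mul0rn addr0.
Qed.

Lemma span_wpair_p t : pspan p wtriple (wpair t *+ p).
Proof. by rewrite -pairing_Xp; exact: span_derived. Qed.

Let sj_nat := span_joint_nat p_gt1 wtriple_torsion span_wpair_p.
Let pp_gt0 : (0 < p * p)%N. Proof. by rewrite muln_gt0 p_gt0. Qed.
Let sjD := spanD sj_nat.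
Let sjN := spanN pp_gt0 (joint_torsion wtriple_torsion span_wpair_p) sj_nat.

Lemma span_joint_der z h : z \in [set: G]^`(1)%g ->
  pspan p (joint wpair wtriple) (w z h).
Proof.
move=> Gz; have [n ->] := span_derived h Gz; apply: (span_sum sj_nat) => t _.
exact/(spanMn sj_nat)/(span_gen sj_nat (inr t)).
Qed.

(** Induction on both arguments: by [pairing_Mr] the defect of additivity consists of values at
    commutators, already covered by [span_joint_der]. *)
Lemma span_wedge g h : pspan p (joint wpair wtriple) (w g h).
Proof.
have Sxx i j : pspan p (joint wpair wtriple) (w (x i) (x j)).
  wlog ij : i j / (i < j)%N => [W|].
    have [ij|ji|/ord_inj->] := ltngtP i j; first exact: W.
      by rewrite (pairing_anti cw); apply/sjN/W.
    by have [_ _ ->] := cw; exact: span0 sj_nat.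
  exact: (span_gen sj_nat (inl (exist _ (i, j) ij : pair_index d))).
have Sxh i k : pspan p (joint wpair wtriple) (w (x i) k).
  move: k; apply: generators_ind => [|k l Sk Sl|j //].
    by rewrite (pairing1r cw); exact: span0 sj_nat.
  rewrite (pairing_Mr class2 cw).
  apply: sjD; last exact/sjN/span_joint_der/lcomm_der.
  by apply: sjD; [exact: sjD | exact/span_joint_der/lcomm_der].
move: g; apply: generators_ind => [|k l Sk Sl|j //].
  by rewrite (pairing1l cw); exact: span0 sj_nat.
rewrite (pairing_anti cw) (pairing_Mr class2 cw); apply: sjN.
apply: sjD; last exact/sjN/span_joint_der/lcomm_der.
apply: sjD; last exact/span_joint_der/lcomm_der.
by apply: sjD; rewrite (pairing_anti cw); exact: sjN.
Qed.

End SpanWedge.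
End Special.

(** * Crossed pairings from second-order coordinates *)

Section Functionals.
Variables (I : Type) (G : groupType) (R : comNzRingType).
Variables (v : I -> G -> R) (W : I -> I -> G -> R).
Local Open Scope ring_scope.
Hypothesis vM : forall i g h, v i (g * h)%g = v i g + v i h.
Hypothesis WM : forall i j g h,
  W i j (g * h)%g = W i j g + W i j h + v j g * v i h.

(** [v i] and [W i j] behave like the coefficients of $X_i$ and $X_jX_i$ in a Magnus expansion
    truncated after degree two; [pairing2] is a $2\times2$ minor of the linear ones. *)
Definition pairing2 (i j : I) (g h : G) : R := v i g * v j h - v j g * v i h.

(* Writing [dg] for the Fox derivative of [g] with respect to the i-th        *)
(* generator, with [h] acting as [exp (\sum_i v i h * X_i)], this is (for      *)
(* [j != k]) the [X_j X_k] coefficient of [(1 - h) dg - (1 - g) dh], the       *)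
(* derivative of the commutator of lifts of [g] and [h].                       *)
Definition pairing3 (i j k : I) (g h : G) : R :=
  v j g * W i k h + v k g * W i j h + v j g * v k g * v i h
  - (v j h * W i k g + v k h * W i j g + v j h * v k h * v i g).

Lemma coord_lconj i g h : v i (lconj g h) = v i h.
Proof.
by apply: (@addIr _ (v i g)); rewrite -vM /lconj mulgVK vM addrC.
Qed.

Lemma coord2_lconj i j g h :
  W i j (lconj g h) = W i j h + v j g * v i h - v j h * v i g.
Proof.
have := WM i j (lconj g h) g; rewrite {1}/lconj mulgVK WM coord_lconj => E.
by apply: (@addIr _ (W i j g + v j h * v i g)); rewrite addrA -E; ring.
Qed.

Lemma coord_lcomm i g h : v i (lcomm g h) = 0.
Proof.
by apply: (@addIr _ (v i h)); rewrite -vM -lconjE coord_lconj add0r.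
Qed.

Lemma coord2_lcomm i j g h :
  W i j (lcomm g h) = v j g * v i h - v j h * v i g.
Proof.
have := WM i j (lcomm g h) h; rewrite -lconjE coord2_lconj coord_lcomm => E.
by apply: (@addIr _ (W i j h)); rewrite -[RHS]addrC addrA E; ring.
Qed.

Lemma pairing2_crossed i j : crossed_pairing (pairing2 i j).
Proof.
split=> *; last by rewrite /pairing2; ring.
  by rewrite /pairing2 !coord_lconj !vM; ring.
by rewrite /pairing2 !coord_lconj !vM; ring.
Qed.

Lemma pairing3_crossed i j k : crossed_pairing (pairing3 i j k).
Proof.
split=> [g g' h|g h h'|g]; last exact: subrr.
  by rewrite /pairing3 !coord2_lconj !coord_lconj !WM !vM; ring.
by rewrite /pairing3 !coord2_lconj !coord_lconj !WM !vM; ring.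
Qed.

Lemma pairing2_lcomm i j g h k : pairing2 i j (lcomm g h) k = 0.
Proof. by rewrite /pairing2 !coord_lcomm; ring. Qed.

Lemma pairing3_lcomm i j k a b c :
  pairing3 i j k (lcomm a b) c =
    v j c * (v i a * v k b - v k a * v i b)
    + v k c * (v i a * v j b - v j a * v i b).
Proof. by rewrite /pairing3 !coord_lcomm !coord2_lcomm; ring. Qed.

End Functionals.

(** * Coordinates on a class-two group of exponent [p] *)

Section Collection.
Variables (G : groupType) (Z : zmodType) (zeta : Z -> G).
Hypothesis class2 : forall g h : G, central (lcomm g h).
Hypothesis zetaD : forall u v, zeta (u + v)%R = zeta u * zeta v.
Hypothesis zeta_inj : injective zeta.
Variable kappa : G -> G -> Z.
Hypothesis zeta_kappa : forall g h, zeta (kappa g h) = lcomm g h.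

Lemma zeta0 : zeta 0%R = 1.
Proof. by apply: (mulgI (zeta 0%R)); rewrite -zetaD addr0 mulg1. Qed.

Lemma kappaMl g g' h : kappa (g * g') h = (kappa g h + kappa g' h)%R.
Proof. by apply: zeta_inj; rewrite zetaD !zeta_kappa lcommMl. Qed.

Lemma kappaMr g h h' : kappa g (h * h') = (kappa g h + kappa g h')%R.
Proof. by apply: zeta_inj; rewrite zetaD !zeta_kappa lcommMr. Qed.

Lemma kappa1r g : kappa g 1 = 0%R.
Proof. by apply: zeta_inj; rewrite zeta0 zeta_kappa lcomm1r. Qed.

Lemma kappa1l g : kappa 1 g = 0%R.
Proof.
by apply: zeta_inj; rewrite zeta0 zeta_kappa lcommV lcomm1r ?invg1.
Qed.

Lemma kappaXr g h n : kappa g (h ^+ n) = (kappa g h *+ n)%R.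
Proof.
by elim: n => [|n IH]; rewrite ?kappa1r // expgS kappaMr IH mulrS.
Qed.

Lemma kappaXl g h n : kappa (g ^+ n) h = (kappa g h *+ n)%R.
Proof.
by elim: n => [|n IH]; rewrite ?kappa1l // expgS kappaMl IH mulrS.
Qed.

(** Collection: moving $x_i^{b_i}$ left past $x_j^{a_j}$ with $j>i$ costs the central factor
    $[x_j,x_i]^{a_jb_i}$. *)
Lemma collect (d : nat) (x : 'I_d -> G) (r : seq 'I_d) (a b : 'I_d -> nat) :
    sorted (fun i j : 'I_d => (i < j)%N) r ->
  (\prod_(i <- r) x i ^+ a i) * (\prod_(i <- r) x i ^+ b i) =
  (\prod_(i <- r) x i ^+ (a i + b i)) *
    zeta (\sum_(i <- r) \sum_(j <- r | (i < j)%N) kappa (x j) (x i) *+ (a j * b i))%R.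
Proof.
have lt_trans : transitive (fun i j : 'I_d => (i < j)%N).
  by move=> j i k; exact: ltn_trans.
elim: r => [|i r IH] /=; first by rewrite !big_nil zeta0 !mulg1.
rewrite path_sortedE // => /andP[ir /IH {}IH].
rewrite !big_cons ltnn.
have -> : (\sum_(j <- r | (i < j)%N) kappa (x j) (x i) *+ (a j * b i) =
           kappa (\prod_(j <- r) x j ^+ a j) (x i ^+ b i))%R.
  rewrite big_mkcond /= {IH}.
  elim: r ir => [|j r IH] /=; first by rewrite !big_nil kappa1l.
  case/andP=> ij /IH {}IH; rewrite !big_cons ij IH kappaMl.
  by rewrite kappaXl !kappaXr mulnC mulrnA.
have -> : (\sum_(k <- r) \sum_(j <- i :: r | (k < j)%N) kappa (x j) (x k) *+ (a j * b k) =
           \sum_(k <- r) \sum_(j <- r | (k < j)%N) kappa (x j) (x k) *+ (a j * b k))%R.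
  rewrite !big_seq; apply: eq_bigr => k kr; rewrite big_cons.
  by rewrite ltnNge (ltnW (allP ir k kr)).
set A := \prod_(j <- r) x j ^+ a j in IH *.
set B := \prod_(j <- r) x j ^+ b j in IH *.
rewrite zetaD zeta_kappa expgD -!mulgA; congr (_ * _).
(* The first power of the second word crosses the whole tail [A] of the first; the central
   commutator that appears is pushed to the right end. *)
rewrite (mulgA A) (mulg_lcomm A) -!mulgA.
rewrite (class2 A (x i ^+ b i) (x i ^+ b i * (A * B))) -!mulgA; congr (_ * _).
by rewrite mulgA IH -mulgA class2.
Qed.

End Collection.

(** * Unique normal forms in exponent [p] and large order *)

Section Coordinates.
Variables (p d : nat) (G : finGroupType).
Hypothesis p_gt1 : (1 < p)%N.
Hypothesis class2 : forall g h : G, central (lcomm g h).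
Hypothesis expX : forall g : G, g ^+ p = 1.
Variable x : 'I_d -> G.
Hypothesis genx : <<[set x i | i : 'I_d]%SET>> = [set: G]%SET.
Hypothesis cardG : (p ^ (d + #|pair_index d|) <= #|G|)%N.

Let center_mulgC (u v : [subg 'Z([set: G])]) : u * v = v * u.
Proof.
apply: val_inj; rewrite /= /mulg /=.
have /centerP[_ cu] := subgP u.
by apply: cu; rewrite finset.inE.
Qed.

Let Z : zmodType := commz center_mulgC.
Let zeta (u : Z) : G := sgval u.

Let zeta_inj : injective zeta. Proof. exact: val_inj. Qed.

Let zetaD u v : zeta (u + v)%R = zeta u * zeta v. Proof. by []. Qed.

Let zeta_central u : central (zeta u).
Proof.
have /centerP[_ cu] := subgP (u : [subg 'Z([set: G])]).
by move=> g; apply: cu; rewrite finset.inE.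
Qed.

Let kappa g h : Z := toz center_mulgC (subg 'Z([set: G]) (lcomm g h)).

Let zeta_kappa g h : zeta (kappa g h) = lcomm g h.
Proof.
rewrite /zeta /kappa /toz subgK //; apply/centerP; split; first by rewrite finset.inE.
by move=> y _; exact: class2.
Qed.

Let gamma (t : pair_index d) : Z := kappa (x (val t).2) (x (val t).1).

Let gamma_torsion t : (gamma t *+ p = 0)%R.
Proof.
rewrite -(kappaXr class2 zetaD zeta_inj zeta_kappa) expX.
exact: (kappa1r class2 zetaD zeta_inj zeta_kappa).
Qed.

Let theta (c : {ffun 'I_d -> 'Z_p} * {ffun pair_index d -> 'Z_p}) : G :=
  (\prod_(i < d) x i ^+ c.1 i) * zeta (comb gamma c.2).

Let thetaM c c' : theta c * theta c' = theta
  ((c.1 + c'.1)%R,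
   (c.2 + c'.2 + [ffun t => c.1 (val t).2 * c'.1 (val t).1])%R).
Proof.
case: c c' => [a m] [b n]; rewrite /theta /=.
set A := \prod_(i <- _) x i ^+ a i; set B := \prod_(i <- _) x i ^+ b i.
set C := \prod_(i <- _) _.
have -> : A * zeta (comb gamma m) * (B * zeta (comb gamma n)) =
          A * B * zeta (comb gamma m + comb gamma n)%R.
  by rewrite zetaD -!mulgA; congr (_ * _); rewrite mulgA zeta_central -mulgA.
have sorted_enum : sorted (fun i j : 'I_d => (i < j)%N) (index_enum 'I_d).
  have := iota_ltn_sorted 0 d.
  by rewrite -val_enum_ord sorted_map enumT [index_enum _]unlock.
rewrite (collect class2 zetaD zeta_inj zeta_kappa _ _ _ sorted_enum).
rewrite -mulgA -zetaD; congr (_ * zeta _).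
  apply: eq_bigr => i _; rewrite ffunE.
  rewrite -[in RHS](natr_Zp (a i)) -[in RHS](natr_Zp (b i)) -natrD.
  by rewrite val_Zp_nat // expg_mod.
rewrite !combD // [in RHS]addrC; congr (_ + _)%R.
rewrite pair_big_dep /=.
have sum_pair (F : 'I_d * 'I_d -> Z) :
    (\sum_(t : 'I_d * 'I_d | (t.1 < t.2)%N) F t = \sum_(t : pair_index d) F (val t))%R.
  exact: (big_sub (fun t : 'I_d * 'I_d => (t.1 < t.2)%N)).
rewrite sum_pair; apply: eq_bigr => t _; rewrite ffunE.
rewrite -[in RHS](natr_Zp (a _)) -[in RHS](natr_Zp (b _)) -natrM.
by rewrite mulr_Zp_nat.
Qed.

Let prod_delta (r : seq 'I_d) i :
  \prod_(j <- r) x j ^+ (j == i) = x i ^+ count_mem i r.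
Proof.
elim: r => [|j r IH] /=; first by rewrite big_nil.
by rewrite big_cons IH; have [->|_] := eqVneq j i; rewrite ?mul1g // -expgS.
Qed.

Let comb0 : comb gamma (0 : {ffun pair_index d -> 'Z_p})%R = 0%R.
Proof. by rewrite /comb big1 // => t _; rewrite ffunE. Qed.

Let theta_gen i : theta ([ffun j => (j == i)%:R%R], 0%R) = x i.
Proof.
have Zp_bool (c : bool) : (c%:R%R : 'Z_p) = c :> nat.
  by rewrite val_Zp_nat // modn_small //; case: c => //; exact: ltnW.
rewrite /theta /= comb0 (zeta0 zetaD) mulg1.
under eq_bigr do rewrite ffunE Zp_bool.
by rewrite prod_delta count_uniq_mem ?index_enum_uniq // mem_index_enum.
Qed.

Let theta_surj g : exists c, theta c = g.
Proof.
move: g; apply: (generators_ind genx) => [|g h [c <-] [c' <-]|i].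
- exists (0%R, 0%R); rewrite /theta /= comb0 (zeta0 zetaD) mulg1.
  by rewrite big1 // => i _; rewrite ffunE.
- by eexists; rewrite thetaM.
- by eexists; exact: theta_gen.
Qed.

(** [theta] is onto from a set of size $p^{d+d(d-1)/2}\le|G|$, hence bijective. The coordinates are
    its inverse, and [thetaM] is their multiplication law. *)
Lemma coordinates : exists (v : 'I_d -> G -> 'Z_p) (n : pair_index d -> G -> 'Z_p),
  [/\ forall i g h, v i (g * h) = (v i g + v i h)%R,
      forall i j, v i (x j) = (i == j)%:R%R
    & forall t g h, n t (g * h) =
        (n t g + n t h + v (val t).2 g * v (val t).1 h)%R].
Proof.
have [c cK] := choice theta_surj.
have /bij_can_sym thK : bijective c.
  apply: inj_card_bij (can_inj cK) _.
  rewrite card_prod !card_ffun !card_ord Zp_cast //.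
  by rewrite -expnD.
have {}thK := (thK theta).2 cK.
exists (fun i g => (c g).1 i), (fun t g => (c g).2 t); split=> [i g h|i j|t g h].
- by rewrite -{1}(cK g) -{1}(cK h) thetaM thK ffunE.
- by rewrite -(theta_gen j) thK ffunE.
- by rewrite -{1}(cK g) -{1}(cK h) thetaM thK !ffunE.
Qed.

Hypothesis p_odd : odd p.

Lemma second_order_coordinates :
  exists (v : 'I_d -> G -> 'Z_p) (W : 'I_d -> 'I_d -> G -> 'Z_p),
  [/\ forall i g h, v i (g * h) = (v i g + v i h)%R,
      forall i j, v i (x j) = (i == j)%:R%R
    & forall i j g h, W i j (g * h) = (W i j g + W i j h + v j g * v i h)%R].
Proof.
have [v [n [vM vx nM]]] := coordinates.
(* The relation $W_{ij}+W_{ji}=v_iv_j$ gives the entries with $i>j$ from those with $i<j$, and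
   dictates $v_i^2/2$ on the diagonal, where [p] must be odd. *)
pose W i j g := (if insub (i, j) is Some t then n t g else
  if insub (j, i) is Some t then v i g * v j g - n t g else v i g * v j g / 2%:R)%R.
exists v, W; split=> // i j g h; rewrite /W.
case: insubP => [t _ Et|/= nij]; first by rewrite nM Et.
case: insubP => [t _ Et|/= nji]; first by rewrite nM Et !vM /=; ring.
have -> : i = j by apply/ord_inj/eqP; rewrite eqn_leq (leqNgt i) nji (leqNgt j) nij.
have u2 : (2%:R : 'Z_p)%R \is a GRing.unit by rewrite unitZpE // coprimen2.
rewrite !vM; apply: (mulIr u2); rewrite !mulrDl !divrK //; ring.
Qed.

End Coordinates.

(** * Counting *)

Lemma sum_ltn_ord (d j : nat) : (j <= d)%N -> (\sum_(i < d) (i < j) = j)%N.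
Proof.
move=> jd; rewrite -big_mkcond /= -(big_ord_widen d (fun=> 1%N) jd).
by rewrite sum_nat_const card_ord muln1.
Qed.

Lemma card_pair_index d : #|pair_index d| = (\sum_(j < d) j)%N.
Proof.
rewrite card_sig -sum1_card big_mkcond /=.
rewrite -(pair_bigA _ (fun i j : 'I_d => (i < j)%N : nat)) exchange_big /=.
by apply: eq_bigr => j _; rewrite sum_ltn_ord // ltnW.
Qed.

(** For a fixed middle index [j] there are [j] choices of [i < j] and [j.+1] choices of [k <= j]. *)
Lemma card_triple_index d : #|triple_index d| = (\sum_(j < d) j * j.+1)%N.
Proof.
rewrite card_sig -sum1_card big_mkcond /=.
rewrite -(pair_bigA _ (fun (t : 'I_d * 'I_d) (k : 'I_d) =>
   ((t.1 < t.2)%N && (k <= t.2)%N : nat))) /=.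
rewrite -(pair_bigA _ (fun i j : 'I_d =>
   \sum_(k < d) ((i < j)%N && (k <= j)%N : nat)))%N exchange_big /=.
apply: eq_bigr => j _.
under eq_bigr => i _.
  under eq_bigr do rewrite -mulnb.
  rewrite -big_distrr /= (sum_ltn_ord (ltn_ord j)); over.
by rewrite -big_distrl /= sum_ltn_ord // ltnW.
Qed.

Lemma card_pairE d : #|pair_index d| = (d * (d - 1) %/ 2)%N.
Proof.
rewrite card_pair_index.
suff -> : (d * (d - 1) = (\sum_(j < d) j) * 2)%N by rewrite mulnK.
elim: d => [|d IH]; first by rewrite big_ord0.
rewrite big_ord_recr /= mulnDl -IH; case: d {IH} => // d; rewrite !subn1 /=; nia.
Qed.

Lemma card_basisE d :
  #|{: pair_index d + triple_index d}| = (d * (d - 1) * (2 * d + 5) %/ 6)%N.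
Proof.
rewrite card_sum card_pair_index card_triple_index -big_split /=.
suff -> : (d * (d - 1) * (2 * d + 5) = (\sum_(j < d) (j + j * j.+1)) * 6)%N.
  by rewrite mulnK.
elim: d => [|d IH]; first by rewrite big_ord0.
rewrite big_ord_recr /= mulnDl -IH; case: d {IH} => // d; rewrite !subn1 /=; nia.
Qed.

(** * Elementary abelian groups *)

Section ZpPower.
Variables (p r : nat).
Hypothesis p_gt1 : (1 < p)%N.

Lemma Zp_powerM (z z' : Zp_power p r) i : (z * z') i = (z i + z' i)%R.
Proof. by rewrite ffunE. Qed.

Lemma Zp_powerX (z : Zp_power p r) : z ^+ p = 1.
Proof.
have E n i : (z ^+ n) i = (z i *+ n)%R.
  by elim: n => [|n IH]; rewrite ?ffunE // expgS Zp_powerM IH mulrS.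
by apply/ffunP => i; rewrite E ffunE -mulr_natr pchar_Zp // mulr0.
Qed.

Lemma card_Zp_power : #|Zp_power p r| = (p ^ r)%N.
Proof.
pose f (z : Zp_power p r) : {ffun 'I_r -> 'Z_p} := [ffun i => z i].
pose h (z : {ffun 'I_r -> 'Z_p}) : Zp_power p r := [ffun i => z i].
have fh : bijective f by exists h => z; apply/ffunP => i; rewrite !ffunE.
by rewrite (bij_eq_card fh) card_ffun !card_ord Zp_cast.
Qed.

End ZpPower.

Section Basis.
Variables (p : nat) (p_gt1 : (1 < p)%N) (G : groupType).
Variable cG : forall x y : G, x * y = y * x.
Variables (T : finType) (e : T -> commz cG).
Hypothesis span_e : forall x, pspan p e x.

Lemma span_card_le : ([set: G] #<= `I_(p ^ #|T|)%N)%card.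
Proof.
have [g gK] := comb_surjective span_e.
have cardT : #|{ffun T -> 'Z_p}| = (p ^ #|T|)%N.
  by rewrite card_ffun card_ord Zp_cast.
pose f (y : G) : nat := enum_rank (g y).
apply/pcard_leP/injfunPex; exists f => [y _|y z _ _ fyz].
  by rewrite /f /= -cardT ltn_ord.
by apply: (can_inj gK); apply: enum_rank_inj; apply: ord_inj.
Qed.

Lemma span_isomorphic : (forall t, e t *+ p = 0)%R ->
    injective (comb (p := p) e) -> isomorphic G (Zp_power p #|T|).
Proof.
move=> ep0 inj_e; have [g gK] := comb_surjective span_e.
have gD x y : g (x + y)%R = (g x + g y)%R by apply: inj_e; rewrite combD // !gK.
pose f (y : G) : Zp_power p #|T| := [ffun i => g y (enum_val i)].
have fM y z : f (y * z) = f y * f z.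
  by apply/ffunP => i; rewrite Zp_powerM !ffunE -[y * z]/((y : commz cG) + z)%R gD ffunE.
pose fm := HB.pack_for {multiplicative G -> Zp_power p #|T|} f (isMultiplicative.Build _ _ f fM).
exists fm.
exists (fun z : Zp_power p #|T| => comb e [ffun t => z (enum_rank t)]).
- move=> y; rewrite -[RHS]gK; congr comb.
  by apply/ffunP => t; rewrite !ffunE enum_rankK.
- move=> z; apply/ffunP => i; rewrite ffunE.
  have -> : g (comb e [ffun t => z (enum_rank t)]) = [ffun t => z (enum_rank t)].
    by apply: inj_e; rewrite gK.
  by rewrite ffunE enum_valK.
Qed.

Lemma isomorphic_torsion r : isomorphic G (Zp_power p r) ->
  forall x : commz cG, (x *+ p = 0)%R.
Proof.
case=> f fbij x; apply: (bij_inj fbij).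
have f1 : f (1 : G) = 1 by apply: (mulgI (f 1)); rewrite -gmulfM !mulg1.
have fX n : f (x *+ n)%R = f x ^+ n.
  elim: n => [|n IH]; first exact: f1.
  by rewrite mulrS expgS -IH -gmulfM.
by rewrite fX Zp_powerX //; symmetry; exact: f1.
Qed.

(** Pigeonhole: a group of order $p^{|T|}$ spanned by the $p^{|T|}$ combinations of [e] has no two
    of them equal. *)
Lemma isomorphic_free : isomorphic G (Zp_power p #|T|) ->
  injective (comb (p := p) e).
Proof.
case=> f [h hK Kh]; have [g gK] := comb_surjective span_e.
have [k _ kK] : bijective (g \o h).
  apply: inj_card_bij.
    by apply: inj_comp; [exact: can_inj gK | exact: can_inj Kh].
  by rewrite card_Zp_power // card_ffun card_ord Zp_cast.
have combE n : comb e n = h (k n) by rewrite -[in LHS](kK n) /= gK.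
move=> n m; rewrite !combE => /(congr1 g) E.
by rewrite -(kK n) -(kK m).
Qed.

End Basis.

(** * Independence of the generators in exponent [p] *)

Lemma dual_pair (R : nzRingType) (i j a b : nat) : (i < j)%N -> (a < b)%N ->
  ((i == a)%:R * (j == b)%:R - (j == a)%:R * (i == b)%:R =
   ((a == i) && (b == j))%:R :> R)%R.
Proof.
move=> ij ab; rewrite -!natrM !mulnb [in RHS]eq_sym (eq_sym b).
suff -> : (j == a) && (i == b) = false by rewrite subr0.
by lia.
Qed.

(** Evaluates [pairing3] on the chosen triples. Both terms contribute exactly when $j=k$, hence the
    factor 2 there. *)
Lemma dual_triple (R : nzRingType) (i j k a b c : nat) :
    (i < j)%N -> (k <= j)%N -> (a < b)%N -> (c <= b)%N ->
  ((j == c)%:R * ((i == a)%:R * (k == b)%:R - (k == a)%:R * (i == b)%:R)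
   + (k == c)%:R * ((i == a)%:R * (j == b)%:R - (j == a)%:R * (i == b)%:R) =
   ((1 + (j == k)) * [&& a == i, b == j & c == k])%:R :> R)%R.
Proof.
move=> ij kj ab cb; rewrite !mulrBr -!natrM !mulnb.
have -> : (j == c) && ((k == a) && (i == b)) = false by lia.
have -> : (k == c) && ((j == a) && (i == b)) = false by lia.
rewrite !subr0 -natrD; congr (_%:R)%R.
lia.
Qed.

Section ExponentP.
Variables (p d : nat) (G : finGroupType).
Hypotheses (p_pr : prime p) (p_odd : odd p).
Hypothesis class2 : forall g h : G, central (lcomm g h).
Variable x : 'I_d -> G.
Variables (v : 'I_d -> G -> 'Z_p) (W : 'I_d -> 'I_d -> G -> 'Z_p).
Local Open Scope ring_scope.
Hypothesis vM : forall i g h, v i (g * h)%g = v i g + v i h.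
Hypothesis vx : forall i j, v i (x j) = (i == j)%:R.
Hypothesis WM : forall i j g h, W i j (g * h)%g = W i j g + W i j h + v j g * v i h.

Let e := joint (wpair x (wedgez class2)) (wtriple x (wedgez class2)).

Lemma wedge_comb (w : G -> G -> 'Z_p) : crossed_pairing w ->
  exists phi : exteriorz class2 -> 'Z_p, forall n : {ffun _ -> 'Z_p},
    phi (comb e n) = \sum_t wpair x w t * n (inl t) + \sum_t wtriple x w t * n (inr t).
Proof.
move=> cw; have [phi [phiM phiw]] := exterior_universal cw.
have phiD (y z : exteriorz class2) : phi (y + z) = phi y + phi z by exact: phiM.
have phi0 : phi (0 : exteriorz class2) = 0.
  by apply: (@addrI _ (phi (0 : exteriorz class2))); rewrite -phiD !addr0.
have phiMn (y : exteriorz class2) n : phi (y *+ n) = phi y *+ n.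
  by elim: n => [|n IH]; rewrite ?mulr0n // !mulrS phiD IH.
have term (y : exteriorz class2) (a : 'Z_p) : phi (y *+ a) = phi y * a.
  by rewrite phiMn -[in RHS](natr_Zp a) mulr_natr.
exists phi => n; rewrite /comb (big_morph phi phiD phi0) big_sumType /=.
by congr (_ + _); apply: eq_bigr => t _; rewrite term; congr (_ * _); exact: phiw.
Qed.

Lemma sum_deltaM (T : finType) (c : 'Z_p) (t0 : T) (n : T -> 'Z_p) (f : T -> 'Z_p) :
  (forall t, f t = c * (t == t0)%:R) -> \sum_t f t * n t = c * n t0.
Proof.
move=> fE; rewrite (bigD1 t0) //= fE eqxx mulr1 big1 ?addr0 // => t /negPf tt0.
by rewrite fE tt0 mulr0 mul0r.
Qed.

(** [pairing2] vanishes on commutators and so reads off the coefficients of the pairs. Once these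
    agree, their contribution to [pairing3] cancels, and the triple coefficients follow after
    division by 1 or 2. *)
Lemma wedge_free : injective (comb (p := p) e).
Proof.
move=> n m nm; have p_gt1 := prime_gt1 p_pr.
have E1 t : n (inl t) = m (inl t).
  case: t => -[i j] /= ij; set t := exist _ _ _.
  have [phi phiE] := wedge_comb (pairing2_crossed vM i j).
  have val_phi q : phi (comb e q) = q (inl t).
    rewrite phiE [X in _ + X]big1 => [|t' _].
      rewrite addr0 (@sum_deltaM _ 1 t) ?mul1r // => -[[a b] /= ab].
      by rewrite /wpair /pairing2 /= !vx mul1r dual_pair.
    by rewrite /wtriple (pairing2_lcomm vM) mul0r.
  by rewrite -val_phi nm val_phi.
apply/ffunP => -[//|t].
case: t => -[[i j] k] /= ijk; set t := exist _ _ _.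
have /andP[/= ij kj] := ijk.
have [phi phiE] := wedge_comb (pairing3_crossed vM WM i j k).
have val_phi (q : {ffun pair_index d + triple_index d -> 'Z_p}) :
    \sum_t wtriple x (pairing3 v W i j k) t * q (inr t) =
    (1 + (j == k))%:R * q (inr t).
  rewrite (@sum_deltaM _ (1 + (j == k))%:R t) // => -[[[a b] c] /= abc].
  have /andP[/= ab cb] := abc.
  rewrite /wtriple /= (pairing3_lcomm vM WM) !vx dual_triple // natrM.
  by rewrite andbA.
have u2 : ((1 + (j == k))%:R : 'Z_p) \is a GRing.unit.
  by rewrite unitZpE //; case: eqP => _; rewrite ?coprimen1 // coprimen2.
have := congr1 phi nm; rewrite !phiE !val_phi => E.
apply: (mulrI u2); apply: addrI (etrans _ E).
by congr (_ + _); apply: eq_bigr => s _; rewrite E1.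
Qed.

End ExponentP.

(** * The converse *)

Section Converse.
Variables (p d : nat) (G : finGroupType).
Hypotheses (p_pr : prime p) (p_odd : odd p) (d_ge3 : (3 <= d)%N).
Hypothesis class2 : forall g h : G, central (lcomm g h).
Hypothesis derX : forall z : G, z \in [set: G]^`(1) -> z ^+ p = 1.
Hypothesis power_der : forall g : G, g ^+ p \in [set: G]^`(1).
Variable x : 'I_d -> G.
Hypothesis genx : <<[set x i | i : 'I_d]%SET>> = [set: G]%SET.

Lemma prod_centralM (T : Type) (r : seq T) (f g : T -> G) :
    (forall t, central (g t)) ->
  \prod_(t <- r) (f t * g t) = (\prod_(t <- r) f t) * (\prod_(t <- r) g t).
Proof.
move=> cg; elim: r => [|t r IH]; first by rewrite !big_nil mulg1.
rewrite !big_cons IH -!mulgA; congr (_ * _).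
by rewrite cg -mulgA cg.
Qed.

Lemma centralX (z : G) n : central z -> central (z ^+ n).
Proof. by move=> cz y; apply: commute_sym; apply: commuteX; apply: commute_sym; exact: cz. Qed.

Let c (t : pair_index d) := lcomm (x (val t).1) (x (val t).2).

Lemma derived_prod z : z \in [set: G]^`(1) ->
  exists n : pair_index d -> nat, z = \prod_t c t ^+ n t.
Proof.
move: z; apply: (derived_ind class2 genx).
- by exists (fun=> 0%N); rewrite big1.
- move=> y z _ [n ->] _ [m ->]; exists (fun t => (n t + m t)%N).
  rewrite -prod_centralM => [|t]; last exact/centralX/class2.
  by apply: eq_bigr => t _; rewrite expgD.
have main (i j : 'I_d) k : (i < j)%N ->
    exists n : pair_index d -> nat, lcomm (x i) (x j) ^+ k = \prod_t c t ^+ n t.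
  move=> ij; pose t : pair_index d := exist _ (i, j) ij.
  exists (fun s => (s == t) * k)%N.
  have E (r : seq (pair_index d)) :
      \prod_(s <- r) c s ^+ ((s == t) * k) = c t ^+ (count_mem t r * k).
    elim: r => [|s r IH] /=; first by rewrite big_nil.
    rewrite big_cons IH mulnDl expgD.
    by have [->|_] := eqVneq s t.
  by rewrite E count_uniq_mem ?index_enum_uniq // mem_index_enum mul1n.
move=> i j; have [ij|ji|/ord_inj->] := ltngtP i j.
- by have := main i j 1%N ij.
(* Exponents are natural numbers, so the inverse of a commutator is written as its power [p.-1]. *)
- rewrite lcommV; have [n E] := main j i p.-1 ji; exists n.
  rewrite -E; apply: (mulgI (lcomm (x j) (x i))).
  by rewrite mulgV -expgS prednK ?prime_gt0 // derX // lcomm_der.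
- by exists (fun=> 0%N); rewrite lcommgg big1.
Qed.

Variables (M : zmodType) (w : G -> G -> M).
Hypothesis cw : crossed_pairing w.
Local Open Scope ring_scope.

Lemma pairing_prod (T : Type) (r : seq T) (f : T -> G) h :
    (forall t, central (f t)) ->
  w (\prod_(t <- r) f t)%g h = \sum_(t <- r) w (f t) h.
Proof.
move=> cf; elim: r => [|t r IH]; first by rewrite !big_nil (pairing1l cw).
by rewrite !big_cons (pairing_centralMl cw) // IH addrC.
Qed.

Let e := joint (wpair x w) (wtriple x w).
Hypothesis torsion : forall y : M, y *+ p = 0.
Hypothesis span_e : forall y, pspan p e y.
Hypothesis free_e : injective (comb (p := p) e).

Lemma dual_basis s : exists phi : M -> 'Z_p,
  [/\ {morph phi : y z / y + z} & forall t, phi (e t) = (t == s)%:R].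
Proof.
have p_gt1 := prime_gt1 p_pr.
have [g gK] := comb_surjective span_e.
have Kg : cancel (comb e) g by move=> n; apply: free_e; rewrite gK.
exists (fun y => g y s); split=> [y z|t].
  have -> : g (y + z) = g y + g z.
    by apply: free_e; rewrite combD // ?gK.
  by rewrite ffunE.
have -> : e t = comb (p := p) e [ffun t' => (t' == t)%:R].
  rewrite -[LHS](sum_delta e); apply: eq_bigr => t' _.
  by rewrite ffunE mulr_Zp_nat.
by rewrite Kg ffunE eq_sym.
Qed.

Lemma index_avoiding (a b : 'I_d) : exists k : 'I_d, (k != a) && (k != b).
Proof.
apply/existsP; apply: contraT; rewrite negb_exists => /forallP H.
have : (#|'I_d| <= #|[set a; b]%SET|)%N.
  by apply: subset_leq_card; apply/fintype.subsetP => k _;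
     rewrite !finset.inE; have := H k; rewrite negb_and !negbK.
by rewrite card_ord cards2; case: (_ != _); lia.
Qed.

(* For [k] distinct from [a] and [b], the coefficient of [lcomm (x a) (x b)]  *)
(* in [z] shows up, up to sign, as the coordinate of [w z (x k)] on the basis *)
(* element [(a, b | k)] if [k < b], and on [(b, k | a)] if [k > b] (Jacobi).  *)
Lemma coefficient_dual (t0 : pair_index d) : exists (k : 'I_d) (phi : M -> 'Z_p) (u : 'Z_p),
  [/\ {morph phi : y z / y + z}, u \is a GRing.unit
    & forall t, phi (w (c t) (x k)) = u * (t == t0)%:R].
Proof.
have phi_basic s phi (phis : forall t, phi (e t) = (t == inr s)%:R) (a b k : 'I_d) :
    (a < b)%N -> (k <= b)%N -> phi (w (lcomm (x a) (x b)) (x k)) =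
      [&& a == (val s).1.1 :> nat, b == (val s).1.2 :> nat & k == (val s).2 :> nat]%:R :> 'Z_p.
  move=> ab kb; have Ht : (a < b)%N && (k <= b)%N by rewrite ab.
  have := phis (inr (exist _ (a, b, k) Ht : triple_index d)).
  rewrite /e /= /wtriple /= => ->.
  have -> : (inr (exist _ (a, b, k) Ht : triple_index d) == inr s :> pair_index d + triple_index d)
     = ((a, b, k) == val s) by [].
  by case: s {phis} => -[[i j] l] ?; rewrite !xpair_eqE -!val_eqE /= andbA.
case: t0 => -[a0 b0] /= ab0.
have [k /andP[ka kb]] := index_avoiding a0 b0.
have additive (phi : M -> 'Z_p) : {morph phi : y z / y + z} ->
    {morph phi : y / - y}.
  move=> phiD y; apply/eqP; rewrite -addr_eq0 -phiD addNr.
  by apply/eqP; apply: (@addrI _ (phi 0)); rewrite -phiD !addr0.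
have jac a b : w (lcomm (x a) (x b)) (x k) =
    - w (lcomm (x b) (x k)) (x a) + w (lcomm (x a) (x k)) (x b).
  have := pairing_jacobi class2 cw (x a) (x b) (x k).
  rewrite (pairing_lcommN class2 cw (x a) (x k)) => /eqP; rewrite subr_eq0 => /eqP <-.
  by rewrite addrC addrK.
have nka : (k != a0 :> nat)%N by rewrite val_eqE.
have eq0 (a b : 'I_d) (ab : (a < b)%N) : ((exist _ (a, b) ab : pair_index d) == exist _ (a0, b0) ab0) =
    (a == a0 :> nat) && (b == b0 :> nat) by [].
case: (ltngtP k b0) kb => [kb _|bk _|/ord_inj->]; last by rewrite eqxx.
  have Hs : (a0 < b0)%N && (k <= b0)%N by rewrite ab0 ltnW.
  have [phi [phiD phis]] := dual_basis (inr (exist _ (a0, b0, k) Hs : triple_index d)).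
  exists k, phi, 1; split=> // [|[[a b] /= ab]]; first exact: unitr1.
  rewrite mul1r /c /= eq0.
  have [kb'|bk] := leqP k b.
    by rewrite (phi_basic _ _ phis) //= eqxx andbT.
  have ak := ltn_trans ab bk.
  rewrite jac phiD (additive _ phiD) !(phi_basic _ _ phis) ?(ltnW bk) ?(ltnW ak) //=.
  have -> : [&& b == a0 :> nat, k == b0 :> nat & a == k :> nat] = false by lia.
  have -> : [&& a == a0 :> nat, k == b0 :> nat & b == k :> nat] = false by lia.
  have -> : (a == a0 :> nat) && (b == b0 :> nat) = false by lia.
  by rewrite oppr0 addr0.
have Hs : (b0 < k)%N && (a0 <= k)%N by rewrite bk (ltnW (ltn_trans ab0 bk)).
have [phi [phiD phis]] := dual_basis (inr (exist _ (b0, k, a0) Hs : triple_index d)).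
exists k, phi, (-1); split=> // [|[[a b] /= ab]]; first by rewrite unitrN unitr1.
rewrite mulN1r /c /= eq0.
have [kb'|bk'] := leqP k b.
  rewrite (phi_basic _ _ phis) //=.
  have -> : [&& a == b0 :> nat, b == k :> nat & k == a0 :> nat] = false by lia.
  have -> : (a == a0 :> nat) && (b == b0 :> nat) = false by lia.
  by rewrite oppr0.
have ak := ltn_trans ab bk'.
rewrite jac phiD (additive _ phiD) !(phi_basic _ _ phis) ?(ltnW bk') ?(ltnW ak) //=.
have -> : [&& a == b0 :> nat, k == k :> nat & b == a0 :> nat] = false by lia.
by rewrite addr0 eqxx /= andbC.
Qed.

(** Write $g^p\in G'$ as $\prod_t c_t^{n_t}$. Since $w(g^p,\cdot)=p\,w(g,\cdot)=0$, the functionals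
    of [coefficient_dual] give $u\,n_t=0$ in $\mathbb{Z}/p$ with $u$ a unit, so each $c_t^{n_t}$ is
    trivial. *)
Lemma exponent_p_of_free (g : G) : (g ^+ p = 1)%g.
Proof.
have p_gt1 := prime_gt1 p_pr.
have [n En] := derived_prod (power_der g).
have wg0 h : w (g ^+ p)%g h = 0 by rewrite (pairing_Xp p_pr p_odd class2 derX cw).
rewrite En big1 // => t _; have [k [phi [u [phiD uu phic]]]] := coefficient_dual t.
have phi0 : phi 0 = 0 by apply: (@addrI _ (phi 0)); rewrite -phiD !addr0.
have phiMn y m : phi (y *+ m) = phi y *+ m.
  by elim: m => [|m IH]; rewrite ?mulr0n // !mulrS phiD IH.
have := wg0 (x k); rewrite En pairing_prod => [|s]; last exact/centralX/class2.
move/(congr1 phi); rewrite phi0 (big_morph phi phiD phi0) (bigD1 t) //=.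
rewrite big1 => [|s /negPf st]; last first.
  rewrite (pairing_centralXl cw); last exact: class2.
  by rewrite phiMn phic st mulr0 mul0rn.
rewrite addr0 (pairing_centralXl cw); last exact: class2.
rewrite phiMn phic eqxx mulr1 => /eqP.
rewrite -mulr_natr -[0](mulr0 u) (can_eq (mulKr uu)) => /eqP/(congr1 val).
rewrite /= val_Zp_nat // => /eqP/dvdnP[q ->].
by rewrite mulnC expgM /c lcommX // expg1n.
Qed.

End Converse.

(** * Special p-groups *)

Section SpecialFacts.
Variables (p d : nat) (H : finGroupType).
Hypotheses (p_pr : prime p) (H_special : special_pgroup p [set: H]%SET).

Let der_center : [set: H]^`(1) = 'Z([set: H]).
Proof. by case: H_special => _ _ [_ ->]. Qed.

Lemma special_class2 (g h : H) : central (lcomm g h).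
Proof.
have : lcomm g h \in 'Z([set: H]) by rewrite -der_center lcomm_der.
by case/centerP=> _ cgh x; apply: cgh; rewrite finset.inE.
Qed.

Lemma special_derX (z : H) : z \in [set: H]^`(1) -> z ^+ p = 1.
Proof.
case: H_special => _ _ _ /(abelemP p_pr)[_ Zp].
by rewrite der_center; exact: Zp.
Qed.

Lemma special_power_der (g : H) : g ^+ p \in [set: H]^`(1).
Proof.
case: H_special => pH _ [PhiZ _] _.
rewrite der_center -PhiZ (Phi_joing pH) mem_gen // finset.inE; apply/orP; right.
have Hg : g \in [set: H]%SET by rewrite finset.inE.
by rewrite -(expn1 p) Mho_p_elt // (mem_p_elt pH).
Qed.

(** Burnside basis argument: lifts of generators of $H/\Phi(H)$ generate $H$, so the elementary
    abelian quotient has rank at least the generator number of $H$. *)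
Lemma grank_Phi : (p ^ 'm([set: H]%SET) <= #|[set: H]%SET / 'Phi([set: H])|)%N.
Proof.
case: H_special => pH _ _ _; set P := 'Phi([set: H]).
have nP : [set: H]%SET \subset 'N(P) by apply: gFnorm.
have abP : p.-abelem ([set: H]%SET / P) by exact: Phi_quotient_abelem.
have [B genB cardB] := grank_witness ([set: H]%SET / P)%G.
rewrite (card_pgroup (abelem_pgroup abP)) leq_exp2l ?prime_gt1 //.
rewrite -(rank_abelem abP) -(grank_abelian (abelem_abelian abP)) -cardB.
pose B' := [set fingroup.repr (b : coset_of P) | b in B]%SET.
suff genB' : <<B'>> = [set: H]%SET.
  by rewrite -[in leqLHS]genB'; apply: leq_trans (grank_min B') (leq_imset_card _ _).
apply: Phi_nongen; apply/eqP; rewrite finset.eqEsubset finset.subsetT /=.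
have sub : [set: H]%SET \subset P * <<B'>>.
  rewrite -quotientSK // quotient_gen ?(fintype.subset_trans (finset.subsetT _) nP) //.
  apply: (@fintype.subset_trans _ _ <<B>>); first by rewrite genB.
  apply: genS; apply/fintype.subsetP => b Bb.
  rewrite -(coset_reprK b); have b'B : fingroup.repr b \in B' by exact: imset_f.
  apply: mem_morphim b'B; exact: (fintype.subsetP nP _ (finset.in_setT _)).
apply: fintype.subset_trans sub _; rewrite mul_subG ?joing_subl //.
by rewrite gen_subG joing_subr.
Qed.

Lemma special_card : (p ^ 'm([set: H]%SET) * #|[set: H]^`(1)| <= #|H|)%N.
Proof.
have PhiD : 'Phi([set: H]) = [set: H]^`(1).
  by case: H_special => _ _ [-> ->].
have L : (#|'Phi([set: H])| * #|[set: H]%SET : 'Phi([set: H])| = #|H|)%N.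
  by rewrite -cardsT; exact: (Lagrange (Phi_sub [set: H]%G)).
rewrite -L -card_quotient; last exact: (gFnorm _ [set: H]%G).
by rewrite -PhiD mulnC leq_mul2l grank_Phi orbT.
Qed.

End SpecialFacts.

Theorem theorem3p3 (p d : nat) (H : finGroupType)
    (p_pr : prime p) (p_neq2 : p <> 2%N) (d_ge3 : (3 <= d)%N)
    (H_special : special_pgroup p [set: H]%SET)
    (H_gen : 'm([set: H]%SET) = d)
    (H_rank : special_rank p [set: H]%SET ((d * (d - 1)) %/ 2)%N) :
  let N := ((d * (d - 1) * (2 * d + 5)) %/ 6)%N in
  [/\ (forall x y : exterior_square H, x * y = y * x),
      ([set: exterior_square H]%classic #<= `I_(p ^ N)%N)%card
    & exponent [set: H]%SET = p <-> isomorphic (exterior_square H) (Zp_power p N)].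
Proof.
move=> N; have p_gt1 := prime_gt1 p_pr.
have p_odd : odd p by case: (even_prime p_pr).
have class2 := special_class2 H_special.
have derX := special_derX p_pr H_special.
have power_der := special_power_der H_special.
have [B genB cardB] := grank_witness [set: H]%G.
have sizeB : size (enum B) = d by rewrite -cardE cardB.
pose x (i : 'I_d) := nth 1 (enum B) i.
have genx : <<[set x i | i : 'I_d]%SET>> = [set: H]%SET.
  rewrite -genB; congr (<< _ >>); apply/setP => b; apply/imsetP/idP => [[i _ ->]|Bb].
    by rewrite -mem_enum mem_nth // sizeB.
  have ib : (index b (enum B) < d)%N by rewrite -sizeB index_mem mem_enum.
  by exists (Ordinal ib); rewrite // /x nth_index // mem_enum.
pose w := wedgez class2; have cw : crossed_pairing w := wedgez_crossed class2.
pose e := joint (wpair x w) (wtriple x w).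
have fp0 : (forall t, wtriple x w t *+ p = 0)%R by exact: wtriple_torsion.
have ep t : pspan p (wtriple x w) (wpair x w t *+ p)%R by exact: span_wpair_p.
have sp_nat := span_joint_nat p_gt1 fp0 ep.
have span_e (y : exteriorz class2) : pspan p e y.
  move: y; apply: exteriorz_ind => [|y z|y|g h].
  - exact: (span0 sp_nat).
  - exact: (spanD sp_nat).
  - apply: (spanN _ (joint_torsion fp0 ep) sp_nat).
    by rewrite muln_gt0 ltnW.
  - exact: span_wedge.
have [cardI cardT] := (card_pairE d, card_basisE d).
split; first exact: exterior_mulgC.
  by rewrite /N -cardT; exact: (span_card_le p_gt1 span_e).
split=> [expH|isoN].
  have expX (g : H) : g ^+ p = 1 by rewrite -expH expg_exponent // finset.inE.
  (* The rank hypothesis enters here: $|H|\ge p^d|H'|$ with $|H'|=p^{d(d-1)/2}$. *)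
  have cardH : (p ^ (d + #|pair_index d|) <= #|H|)%N.
    rewrite expnD cardI; have := special_card p_pr H_special.
    by rewrite H_gen H_rank.
  have [v [W [vM vx WM]]] := second_order_coordinates p_gt1 class2 expX genx cardH p_odd.
  rewrite /N -cardT; apply: (span_isomorphic p_gt1 span_e); last exact: wedge_free vM vx WM.
  case=> t; last exact: fp0.
  (* In exponent [p] the pairs are torsion too, because $p\,w(x_i,x_j)=w(x_i^p,x_j)$. *)
  by rewrite /e /= /wpair -(pairing_Xp p_pr p_odd class2 derX cw) expX (pairing1l cw).
have iso_pN : isomorphic (exterior_square H)
    (Zp_power p #|{: pair_index d + triple_index d}|) by rewrite cardT.
have expX := exponent_p_of_free p_pr p_odd d_ge3 class2 derX power_der genx cw
  (isomorphic_torsion p_gt1 iso_pN) span_e (isomorphic_free p_gt1 span_e iso_pN).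
have : (exponent [set: H]%SET %| p)%N by apply/exponentP => g _; exact: expX.
case/(primeP p_pr).2/orP => /eqP // exp1.
(* The exponent divides [p]; the value 1 would make [H] trivial, against its being non-abelian. *)
case: H_special => _ /negP[].
by have := trivg_exponent [set: H]%G; rewrite exp1 dvdn1 eqxx => /eqP ->; exact: abelian1.
Qed.
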